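(* Let $G$ be a countable group acting via isometries on a proper, geodesic metric space $(X, d)$ with a non-trivial, stably visible compactification $\overline{X}$. Let $\mu$ be a probability measure on $G$ such that the subgroup generated by the support of $\mu$ is non-elementary, and such that $\mu$ has finite first moment. Then there exists $A \geq 0$ such that, for each $x \in X$ and for almost every sample path $(w_n x)$, there exists a geodesic ray $\gamma : [0, \infty) \to X$ such that $$\lim_{n \to \infty} \frac{d(w_n x, \gamma(An))}{n} = 0.$$
   Context: A geodesic segment (ray, line) in $X$ is an isometric embedding into $X$ of a compact interval (of $[0,\infty)$, of $\mathbb{R}$). $X$ is geodesic if any two points are joined by a geodesic segment, and proper if closed balls are compact. A bordification $\overline{X}$ of $X$ is a Hausdorff, second-countable topological space such that $X$ is homeomorphic to (and identified with) an open dense subset of $\overline{X}$ and such that the action of $G$ on $X$ extends to an action on $\overline{X}$ by homeomorphisms. Its boundary is $\partial X := \overline{X}\setminus X$. A compactification is a compact bordification. It is non-trivial if $\partial X$ contains at least three points. It is stably visible if, given any sequence $\gamma_n = [\eta_n,\xi_n]$ of geodesic segments in $X$ connecting $\eta_n$ with $\xi_n$ and such that $\xi_n\to\xi\in\partial X$, $\eta_n\to\eta\in\partial X$ with $\eta\ne\xi$, there exists a bounded set $B\subseteq X$ which intersects all $\gamma_n$. A subgroup $G'\subseteq G$ is elementary (with respect to $\overline{X}$) if there is a nonempty finite subset $E\subset\partial X$ with $gE=E$ for all $g\in G'$; otherwise it is non-elementary. Random walk: $\mathbb{P}=\mu^{\mathbb{N}}$ is the product measure on sequences $(g_1,g_2,\dots)\in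 G^{\mathbb{N}}$, $w_n := g_1\cdots g_n$; the sample path is $(w_nx)_{n}$, and ''almost every'' is with respect to $\mathbb{P}$. Finite first moment: $\int_G d(x,gx)\,d\mu(g)<\infty$ for some $x\in X$. *)

(* Defs.v *)
From HB Require Import structures.
From mathcomp Require Import all_boot all_order all_algebra.
From mathcomp Require Import all_classical all_reals all_analysis.

Set Implicit Arguments.
Unset Strict Implicit.
Unset Printing Implicit Defensive.

Import Order.TTheory GRing.Theory Num.Theory.
Import numFieldNormedType.Exports.

Local Open Scope classical_set_scope.
Local Open Scope ring_scope.

Section geodesics.
Context {R : realType} {X : metricType R}.

(* A geodesic is given by a total map, of which only the restriction to the
   interval I matters. *)
Definition isometric_embedding_on (I : set R) (gamma : R -> X) : Prop :=
  forall s t, I s -> I t -> mdist (gamma s) (gamma t) = `|s - t|.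

Definition geodesic_segment (a b : R) (x y : X) (gamma : R -> X) : Prop :=
  [/\ a <= b, isometric_embedding_on `[a, b] gamma, gamma a = x & gamma b = y].

Definition geodesic_ray (gamma : R -> X) : Prop :=
  isometric_embedding_on `[0, +oo[ gamma.

Definition metric_bounded (B : set X) : Prop :=
  exists (x : X) (r : R), forall y, B y -> mdist x y <= r.

End geodesics.

Definition geodesic_space {R : realType} (X : metricType R) : Prop :=
  forall x y : X, exists a b gamma, geodesic_segment a b x y gamma.

(* The library's [closed_ball] is the closure of the open ball, which may be
   smaller than the closed ball. *)
Definition proper_space {R : realType} (X : metricType R) : Prop :=
  forall (x : X) (r : R), compact [set y | mdist x y <= r].

Definition is_group_action {G : groupType} {T : Type} (act : G -> T -> T) :
    Prop :=
  (forall x, act 1%g x = x) /\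
  (forall g h x, act (g * h)%g x = act g (act h x)).

Definition isometric_action {R : realType} {X : metricType R} {G : groupType}
    (act : G -> X -> X) : Prop :=
  is_group_action act /\
  forall g x y, mdist (act g x) (act g y) = mdist x y.

Section bordifications.
Context {R : realType} {X : metricType R} {G : groupType}.
Variable act : G -> X -> X.
Context {Xbar : topologicalType}.
Variables (iota : X -> Xbar) (actbar : G -> Xbar -> Xbar).

Definition homeo_onto_image : Prop :=
  [/\ injective iota, continuous iota &
      forall U : set X, open U -> exists2 V, open V & U = iota @^-1` V].

(* Continuity of every [actbar g] gives homeomorphisms, the inverse of
   [actbar g] being [actbar g^-1].  The extension [actbar] is unique, since X
   is dense and Xbar is Hausdorff. *)
Definition bordification : Prop :=
  [/\ hausdorff_space Xbar /\ @second_countable Xbar,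
      homeo_onto_image,
      open (range iota) /\ dense (range iota),
      is_group_action actbar /\ (forall g, continuous (actbar g)) &
      forall g x, actbar g (iota x) = iota (act g x)].

Definition compactification : Prop :=
  bordification /\ compact [set: Xbar].

Definition boundary : set Xbar := ~` range iota.

Definition nontrivial_bordification : Prop :=
  exists a b c, [/\ boundary a, boundary b & boundary c] /\
                [/\ a <> b, b <> c & a <> c].

Definition stably_visible : Prop :=
  forall (eta_ xi_ : nat -> X) (a b : nat -> R) (gamma : nat -> R -> X)
         (eta xi : Xbar),
    (forall n, geodesic_segment (a n) (b n) (eta_ n) (xi_ n) (gamma n)) ->
    boundary xi -> iota (xi_ n) @[n --> \oo] --> xi ->
    boundary eta -> iota (eta_ n) @[n --> \oo] --> eta ->
    eta <> xi ->
    exists2 B : set X, metric_bounded B &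
      forall n, B `&` (gamma n @` `[a n, b n]) !=set0.

Definition elementary (H : set G) : Prop :=
  exists E : set Xbar,
    [/\ finite_set E, E !=set0, E `<=` boundary &
        forall g, H g -> actbar g @` E = E].

End bordifications.

Definition generated_subgroup {G : groupType} (S : set G) : set G :=
  smallest (fun H : set G => group_closed (mem H)) S.

Definition discrete_group (G : groupType) : Type := G.

Section discrete_group.
Variable G : groupType.

HB.instance Definition _ := Group.on (discrete_group G).
HB.instance Definition _ := isPointed.Build (discrete_group G) (1%g : G).
HB.instance Definition _ := @isMeasurable.Build default_measure_display
  (discrete_group G) discrete_measurable discrete_measurable0
  discrete_measurableC discrete_measurableU.

End discrete_group.

(* The product sigma-algebra on G^N is generated by the coordinate maps; the
   coordinate [omega i] stands for the increment g_(i+1). *)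
Definition coordinate_sets (G : groupType) :
    set (set (nat -> discrete_group G)) :=
  \bigcup_i preimage_set_system [set: nat -> discrete_group G]
              (fun omega => omega i) measurable.

Definition increments (G : groupType) :=
  g_sigma_algebraType (@coordinate_sets G).

(* This determines P, the cylinders being a pi-system generating the product
   sigma-algebra. *)
Definition is_product_measure {R : realType} {G : groupType}
    (mu : probability (discrete_group G) R)
    (P : probability (increments G) R) : Prop :=
  forall (n : nat) (A : 'I_n -> set (discrete_group G)),
    P [set omega : increments G | forall i : 'I_n, A i (omega i)] =
    (\prod_(i < n) mu (A i))%E.

(* For the discrete topology on a countable group, the support is the set of
   atoms. *)
Definition measure_support {R : realType} {G : groupType}
    (mu : probability (discrete_group G) R) : set G :=
  [set g | (0 < mu [set g])%E].

Definition finite_first_moment {R : realType} {X : metricType R}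
    {G : groupType} (act : G -> X -> X)
    (mu : probability (discrete_group G) R) : Prop :=
  exists x : X, (\int[mu]_g (mdist x (act g x))%:E < +oo)%E.

Definition walk {G : groupType} (omega : increments G) (n : nat) : G :=
  (\prod_(i < n) (omega i : G))%g.

(* Main.v *)
(** Write a_n = d(o, w_n o) and let A be its drift. If A = 0, any ray works. If
    A > 0, Garsia's maximal inequality, applied to the increments of the
    subadditive cocycle a_n, gives with positive probability infinitely many
    times n such that a_n - d(w_k o, w_n o) >= (A/2) k for all k <= n. The Gromov
    products of w_k o and w_n o then go to infinity, so by stable visibility w_n o
    converges to a boundary point, almost surely by the zero-one law. The same
    holds for the backward walk; the two limits are independent, and differ with
    positive probability, since otherwise they would be a single point of the
    boundary, fixed by the support of mu. When they differ, stable visibility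
    bounds the distance D from o to all geodesics between w_(-m) o and w_n o.
    Under the bilateral shift T, D o T <= D + d(o, g_1 o), hence D o T^k = o(k):
    w_k o is at distance o(k) from every geodesic from o to w_n o with n >= k,
    and so from a limit ray of these geodesics. Being tracked by a ray does not
    depend on the first increments, so positive probability suffices. *)
Require Import Defs.
From HB Require Import structures.
From mathcomp Require Import all_boot all_order all_algebra.
From mathcomp Require Import all_classical all_reals all_analysis.
From mathcomp Require Import measurable_realfun zify lra.

Set Implicit Arguments.
Unset Strict Implicit.
Unset Printing Implicit Defensive.

Import Order.TTheory GRing.Theory Num.Theory.
Import numFieldNormedType.Exports.

Local Open Scope classical_set_scope.
Local Open Scope ring_scope.

(** * Product measures on sequences of increments *)

(** Neither the boundary limit nor D is available as a real random variable: no sigma-algebra is put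
    on [Xbar], and D may be infinite. Every event is therefore a countable combination of relations
    between finitely many positions of the walk, measurable because [G] is countable, and D enters
    only through the conditions D <= r. Nor is D known to be integrable. Its sublinear growth along
    orbits where it is finite comes from the maximal inequality, applied to the increments d(o, g_1
    o) kept only where D o T is finite but exceeds a constant C; their mean tends to 0 as C grows.
    The drift is taken as the infimum of E a_n / n. The almost sure convergence of a_n / n to it
    rests on the same inequality: for the lower bound, on the increments of the cocycle; for the
    upper one, on blocks of a fixed length. That the two limits differ is expressed by disjoint open
    sets which the two walks eventually enter. *)

Section relabeling.
Context {G : groupType}.
Notation Omega := (increments G).
Notation GG := (discrete_group G).

(** Shifts, the even and odd halves of a sequence, the bilateral shift and the reversal of an
    initial block all have this form with [b] injective, so that one lemma makes all of them
    preserve [P]. *)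
Definition relabel (b : nat -> nat) (omega : Omega) : Omega :=
  fun i => omega (b i).

(** The index map is free so that preimages under relabelings and intersections of cylinders are
    again cylinders. *)
Definition cylinder (m : nat) (i : nat -> nat) (A : nat -> set GG) : set Omega :=
  [set omega | forall k, (k < m)%N -> A k (omega (i k))].

Lemma measurable_coord (i : nat) :
  measurable_fun [set: Omega] (fun omega : Omega => omega i : GG).
Proof.
move=> _ Y mY; apply: sub_sigma_algebra; exists i => //.
by exists Y.
Qed.

Lemma measurable_increments d (T : measurableType d) (f : T -> Omega) :
  (forall i, measurable_fun [set: T] (fun t => f t i : GG)) ->
  measurable_fun [set: T] f.
Proof.
move=> mf; apply: (@measurability _ _ T Omega setT f (@coordinate_sets G) erefl).
move=> _ [_ [i _ [B mB <-]] <-].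
rewrite setTI setTI.
have := mf i measurableT B mB.
by rewrite setTI.
Qed.

Lemma measurable_relabel (b : nat -> nat) : measurable_fun setT (relabel b).
Proof. by apply: measurable_increments => i; exact: measurable_coord. Qed.

Lemma measurable_relabel_preimage b (F : set Omega) :
  measurable F -> measurable (relabel b @^-1` F).
Proof. by move=> mF; rewrite -[X in measurable X]setTI; exact: measurable_relabel. Qed.

Lemma measurable_cylinder m i A : measurable (cylinder m i A).
Proof.
have -> : cylinder m i A = \bigcap_(k in [set k | (k < m)%N])
    ((fun omega : Omega => omega (i k)) @^-1` A k) by [].
apply: bigcap_measurableType => k _.
by rewrite -[X in measurable X]setTI; exact: measurable_coord.
Qed.

Lemma cylinder_relabel b m i A :
  relabel b @^-1` cylinder m i A = cylinder m (b \o i) A.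
Proof. by []. Qed.

Lemma cylinderI m i A m' i' A' :
  cylinder m i A `&` cylinder m' i' A' =
  cylinder (m + m') (fun k => if (k < m)%N then i k else i' (k - m)%N)
                    (fun k => if (k < m)%N then A k else A' (k - m)%N).
Proof.
apply/seteqP; split => [omega [h h'] k km|omega h].
  case: ifPn => [|]; first exact: h.
  by rewrite -leqNgt => mk; apply: h'; rewrite ltn_subLR.
split => k km.
  by have := h k; rewrite km; apply; rewrite ltn_addr.
have := h (m + k)%N; rewrite (ltnNge (m + k) m) leq_addr/= addKn; apply.
by rewrite ltn_add2l.
Qed.

Definition initial_cylinders : set (set Omega) :=
  [set C | exists m A, C = cylinder m id A].

Lemma initial_cylindersI : setI_closed initial_cylinders.
Proof.
move=> _ _ [m [A ->]] [n [B ->]]; exists (maxn m n).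
exists (fun k => (if (k < m)%N then A k else setT) `&`
                 (if (k < n)%N then B k else setT)).
apply/seteqP; split => [omega [hA hB] k _|omega h].
  by split; case: ifP => // kl; [exact: hA|exact: hB].
by split=> k kl; have [] := h k; rewrite ?leq_max ?kl ?orbT//=.
Qed.

Lemma measurable_initial_cylinders :
  @measurable _ Omega = <<s initial_cylinders >>.
Proof.
apply/seteqP; split.
  apply: smallest_sub; first exact: smallest_sigma_algebra.
  move=> _ [i _ [B _ <-]]; apply: sub_sigma_algebra.
  exists i.+1; exists (fun k => if k == i then B else setT).
  rewrite setTI; apply/seteqP; split => [omega /= h k _|omega h/=].
    by case: eqP => [->|].
  by have := h i (leqnn _); rewrite eqxx.
apply: smallest_sub; first exact: smallest_sigma_algebra.
by move=> _ [m [A ->]]; exact: measurable_cylinder.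
Qed.

End relabeling.

Section product.
Context {R : realType} {G : groupType}.
Notation Omega := (increments G).
Notation GG := (discrete_group G).
Variables (mu : probability GG R) (P : probability Omega R).
Hypothesis PP : is_product_measure mu P.

(** The defining property of [P] constrains all coordinates below some [n]. With [n] beyond every
    index, coordinate [j] is constrained by [A k] if [i k = j], for at most one [k] by injectivity,
    and otherwise by the whole group, which contributes a factor 1. *)
Lemma prob_cylinder m i A :
  (forall k l, (k < m)%N -> (l < m)%N -> i k = i l -> k = l) ->
  P (cylinder m i A) = (\prod_(k < m) mu (A k))%E.
Proof.
move=> inj.
pose n := (\max_(k < m) i k).+1.
have lt_in (k : 'I_m) : (i k < n)%N by rewrite ltnS /n (leq_bigmax k).
pose B (j : 'I_n) := \bigcap_(k in [set k : nat | (k < m)%N /\ i k = j]) A k.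
have -> : cylinder m i A = [set omega : Omega | forall j : 'I_n, B j (omega j)].
  apply/seteqP; split => [omega h j k [km <-]|omega h k km]; first exact: h.
  by apply: (h (Ordinal (lt_in (Ordinal km))) k).
rewrite PP (partition_big (fun k => Ordinal (lt_in k)) predT)//=.
apply: eq_bigr => j _.
have [[k /eqP ikj]|nex] := pselect (exists k : 'I_m, Ordinal (lt_in k) == j).
  rewrite (big_pred1 k) => [|l]; last first.
    apply/idP/idP => [/eqP ilj|/eqP->]; last exact/eqP.
    apply/eqP/val_inj/inj; rewrite ?ltn_ord//.
    by move: (congr1 val ikj); rewrite -ilj.
  congr (mu _); apply/seteqP; split => [g /(_ k)|g Ag l [lm il]]; first apply.
    by split => //; rewrite -ikj.
  by rewrite (inj l k)// il -ikj.
rewrite big_pred0 => [|l]; last by apply/negP => h; apply: nex; exists l.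
have -> : B j = setT; last exact: probability_setT.
rewrite -subTset => g _ k [km ikj]; exfalso; apply: nex.
by exists (Ordinal km); apply/eqP/val_inj.
Qed.

Lemma product_induction (D : set Omega -> Prop) :
  (forall m A, D (cylinder m id A)) ->
  (forall S, measurable S -> D S -> D (~` S)) ->
  (forall F : (set Omega)^nat, (forall n, measurable (F n)) ->
    trivIset [set: nat] F -> (forall n, D (F n)) -> D (\bigcup_k F k)) ->
  forall S, measurable S -> D S.
Proof.
move=> Dcyl DC DU S mS.
apply: (@dynkin_induction _ Omega initial_cylinders D) => //.
- exact: measurable_initial_cylinders.
- exact: initial_cylindersI.
- have <- : cylinder 0 id (fun=> set0 : set GG) = setT by rewrite -subTset.
  exact: Dcyl.
- by move=> _ [m [A ->]].
- by rewrite -measurable_initial_cylinders.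
Qed.

(** The sets [F] that satisfy the product formula are stable under complement and countable disjoint
    union, [P E] being finite; the pi-lambda theorem leaves the cylinders. *)
Lemma indep_induction (E : set Omega) (b : Omega -> Omega) (c : \bar R) :
  measurable E -> c \is a fin_num -> c = P E ->
  measurable_fun setT b ->
  (forall m A, P (E `&` b @^-1` cylinder m id A) = c * P (cylinder m id A))%E ->
  forall F, measurable F -> (P (E `&` b @^-1` F) = c * P F)%E.
Proof.
move=> mE fc cE mb hcyl.
have mbF F : measurable F -> measurable (b @^-1` F).
  by move=> mF; rewrite -[X in measurable X]setTI; exact: mb.
apply: product_induction => [//|S mS /= DS|F mF tF /= DF].
  have -> : E `&` b @^-1` (~` S) = E `\` (E `&` b @^-1` S).
    by rewrite preimage_setC setDIr setDv set0U setDE.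
  rewrite measureD//; last 2 first.
  - by apply: measurableI => //; exact: mbF.
  - by rewrite ltey_eq fin_num_measure.
  rewrite setIA setIid probability_setC// muleBr ?fin_num_adde_defr//.
  rewrite mule1 {1}cE; congr (_ - _)%E; exact: DS.
rewrite preimage_bigcup setI_bigcupr measure_bigcup//; last 2 first.
- by move=> k _; apply: measurableI => //; exact: mbF.
- apply/trivIsetP => i j _ _ ij; move/trivIsetP: tF => /(_ i j I I ij) tij.
  by rewrite setIACA setIid -preimage_setI tij preimage_set0 setI0.
rewrite measure_bigcup//= -[in RHS](fineK fc) -nneseriesZl//.
by apply: eq_eseriesr => k _; rewrite fineK//; exact: DF.
Qed.

Lemma indep_cylinder m i A (b : nat -> nat) :
  (forall k l, (k < m)%N -> (l < m)%N -> i k = i l -> k = l) ->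
  injective b -> (forall k l, (k < m)%N -> i k <> b l) ->
  forall F, measurable F ->
  (P (cylinder m i A `&` relabel b @^-1` F) = P (cylinder m i A) * P F)%E.
Proof.
move=> inji injb ib F mF.
apply: indep_induction => //.
- exact: measurable_cylinder.
- by rewrite fin_num_measure//; exact: measurable_cylinder.
- exact: measurable_relabel.
move=> n B; rewrite cylinder_relabel cylinderI !prob_cylinder//.
  rewrite big_split_ord/=; congr (_ * _)%E; apply: eq_bigr => k _ /=.
    by rewrite ltn_ord.
  by rewrite ltnNge leq_addr/= addKn.
move=> k l km lm; case: ifPn => hk; case: ifPn => hl.
- exact: inji.
- by move=> e; case: (ib _ (l - m)%N hk).
- by move=> /esym e; case: (ib _ (k - m)%N hl).
- move=> /injb e; move: hk hl; rewrite -!leqNgt => hk hl.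
  by rewrite -(subnK hk) -(subnK hl); move: e => /= ->.
Qed.

Lemma cylinder0 i A : cylinder 0 i A = [set: Omega].
Proof. by rewrite -subTset. Qed.

Lemma prob_relabel (b : nat -> nat) : injective b ->
  forall F, measurable F -> P (relabel b @^-1` F) = P F.
Proof.
move=> injb F mF; have := @indep_cylinder 0 id (fun=> set0) b.
rewrite cylinder0 => /(_ (fun _ _ _ => _) injb _ F mF).
by rewrite setTI probability_setT mul1e; apply.
Qed.

(** The pi-lambda argument treats one factor at a time: [indep_cylinder] has already freed [F], and
    here [E] varies. *)
Lemma indep_relabel (a b : nat -> nat) : injective a -> injective b ->
  (forall k l, a k <> b l) ->
  forall E F, measurable E -> measurable F ->
  (P (relabel a @^-1` E `&` relabel b @^-1` F) = P E * P F)%E.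
Proof.
move=> inja injb ab E F mE mF.
rewrite setIC muleC -[P F](prob_relabel injb)//.
apply: indep_induction => //.
- exact: measurable_relabel_preimage.
- by rewrite fin_num_measure//; exact: measurable_relabel_preimage.
- exact: measurable_relabel.
move=> m A; rewrite setIC muleC cylinder_relabel indep_cylinder//.
- by rewrite -cylinder_relabel !prob_relabel//; exact: measurable_cylinder.
- by move=> k l _ _ /inja.
Qed.

Definition tailn (n : nat) : Omega -> Omega := relabel (addn n).

(** As the shift preserves [P], the inclusion forces [N] to agree up to a null set with its preimage
    under [p * m] steps. That preimage is independent of the first [m] coordinates, so [N] is
    independent of every cylinder, hence of itself, and P(N) = P(N)^2. *)
Lemma zero_one (N : set Omega) p : (0 < p)%N -> measurable N ->
  N `<=` tailn p @^-1` N -> P N = 0%E \/ P N = 1%E.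
Proof.
move=> p0 mN NS.
have mS n : measurable (tailn n @^-1` N) by exact: measurable_relabel_preimage.
have PS n : P (tailn n @^-1` N) = P N by rewrite prob_relabel//; exact: addnI.
have NSn n : N `<=` tailn (p * n) @^-1` N.
  elim: n => [|n IHn] omega Nomega.
    by rewrite muln0; have -> : tailn 0 = id by apply/funext.
  have := NS _ (IHn _ Nomega); rewrite /tailn/relabel /preimage/= mulnS.
  by congr (N _); apply/funext => i; congr (omega _); lia.
have indN (E : set Omega) : measurable E -> (P (N `&` E) = P N * P E)%E.
  move=> mE; have -> : E = (fun omega => omega) @^-1` E by [].
  apply: indep_induction => //; first by rewrite fin_num_measure.
  move=> m A; rewrite preimage_id setIC muleC.
  rewrite -[in RHS](PS (p * m)%N) PS -(@indep_cylinder m id A (addn (p * m)%N))//.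
  - have h : P (tailn (p * m) @^-1` N `\` N) = 0%E.
      rewrite measureD//; last by rewrite ltey_eq fin_num_measure.
      rewrite (setIidr (NSn m)); transitivity (P N - P N)%E.
        by congr (_ - _)%E; exact: PS.
      by rewrite subee// fin_num_measure.
    have mC := measurable_cylinder m id A.
    have mD : measurable (tailn (p * m) @^-1` N `\` N) by exact: measurableD.
    have mCN := measurableI _ _ mC mN.
    have mCS := measurableI _ _ mC (mS (p * m)%N).
    apply/eqP; rewrite eq_le; apply/andP; split.
      by apply: le_measure; rewrite ?inE//; apply: setIS; exact: NSn.
    rewrite -[leRHS]adde0 -h; apply: le_trans (measureU2 _ mCN mD).
    apply: le_measure; rewrite ?inE//; first exact: measurableU.
    move=> omega [Co So]; have [No|No] := pselect (N omega); first by left.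
    by right.
  - exact: addnI.
  - by move=> k l km; nia.
have := indN N mN; rewrite setIid -(@fineK _ (P N)) ?fin_num_measure//.
rewrite -EFinM => -[e].
have [->|n0] := eqVneq (fine (P N)) 0; [by left|right].
by congr EFin; apply: (mulfI n0); rewrite mulr1.
Qed.

(** The event of never entering [M] along multiples of [p] is included in its own shift preimage,
    and it avoids [M], which rules out probability 1. *)
Lemma recurrence (M : set Omega) p : (0 < p)%N -> measurable M ->
  (0 < P M)%E -> {ae P, forall omega, exists n, M (tailn (p * n) omega)}.
Proof.
move=> p0 mM PM.
pose N := \bigcap_n tailn (p * n) @^-1` (~` M).
have mN : measurable N.
  by apply: bigcapT_measurable => n; apply: measurable_relabel_preimage; exact: measurableC.
exists N; split => //; last first.
  by move=> omega /forallNP h n _ /=; exact: h.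
have : N `<=` tailn p @^-1` N.
  move=> omega Nomega n _; have := Nomega n.+1 I.
  rewrite /tailn/relabel/preimage/=.
  by apply: contra_not; congr M; apply/funext => i; congr omega; lia.
move=> /(zero_one p0 mN)[//|PN1]; exfalso.
have : (P N <= P (~` M))%E.
  apply: le_measure; rewrite ?inE//; first exact: measurableC.
  move=> omega /(_ 0%N I); rewrite muln0.
  by have -> : tailn 0 = id by apply/funext.
rewrite PN1 probability_setC//.
rewrite -(@fineK _ (P M)) ?fin_num_measure// -EFinB lee_fin.
move: PM; rewrite -(@fineK _ (P M)) ?fin_num_measure// lte_fin.
lra.
Qed.

(** No measurability of [Q] is involved: almost every orbit visits the event [M], and [Q] is carried
    back from the time of the visit to time 0. *)
Lemma ae_backward_invariant (Q : Omega -> Prop) (M : set Omega) p :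
  (0 < p)%N -> measurable M -> (0 < P M)%E -> M `<=` Q ->
  (forall omega, Q (tailn p omega) -> Q omega) ->
  {ae P, forall omega, Q omega}.
Proof.
move=> p0 mM PM MQ QS; apply: filterS (recurrence p0 mM PM) => omega [n].
move=> /MQ; elim: n omega => [|n IHn] omega.
  by rewrite muln0; have -> : tailn 0 = id by apply/funext.
move=> h; apply: QS; apply: IHn; move: h; congr Q.
by apply/funext => i; rewrite /tailn/relabel; congr omega; lia.
Qed.

End product.

(** * Maximal inequalities and sublinear growth *)

Section transfer.
Context d1 d2 (X : measurableType d1) (Y : measurableType d2) (R : realType).
Variables (phi : X -> Y) (mphi : measurable_fun [set: X] phi).
Variables (mu : {measure set X -> \bar R}) (nu : {measure set Y -> \bar R}).
Hypothesis munu : forall F, measurable F -> mu (phi @^-1` F) = nu F.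

Lemma ge0_integral_transfer (f : Y -> \bar R) :
  measurable_fun [set: Y] f -> (forall y, 0 <= f y)%E ->
  (\int[nu]_y f y = \int[mu]_x f (phi x))%E.
Proof.
move=> mf f0; rewrite -(@ge0_integral_pushforward _ _ _ _ _ _ mphi mu setT f)//.
by apply: eq_measure_integral => A mA _; rewrite -munu.
Qed.

Lemma integrable_transfer (f : Y -> R) :
  nu.-integrable setT (EFin \o f) -> mu.-integrable setT (EFin \o (f \o phi)).
Proof.
move=> /integrableP[mf fi]; apply/integrableP; split.
  exact: measurableT_comp mf mphi.
rewrite -(ge0_integral_transfer (f := fun y => `|(f y)%:E|%E))//.
exact: measurableT_comp.
Qed.

Lemma Rintegral_transfer (f : Y -> R) :
  nu.-integrable setT (EFin \o f) ->
  \int[nu]_y f y = \int[mu]_x f (phi x).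
Proof.
move=> fi; have mf := measurable_int _ fi.
rewrite /Rintegral; congr fine.
transitivity (\int[pushforward mu phi]_y (f y)%:E)%E.
  by apply: eq_measure_integral => A mA _; rewrite -munu.
by rewrite integral_pushforward//; exact: integrable_transfer.
Qed.

End transfer.

Section integrability.
Context d (T : measurableType d) (R : realType) (P : probability T R).
Implicit Types (f g : T -> R).

Definition intble f := P.-integrable setT (EFin \o f).

Lemma intble_measurable f : intble f -> measurable_fun setT f.
Proof. by move=> /(measurable_int P)/measurable_EFinP. Qed.

Lemma intbleD f g : intble f -> intble g -> intble (fun x => f x + g x).
Proof. by move=> fi gi; exact: (integrableD measurableT fi gi). Qed.

Lemma intbleB f g : intble f -> intble g -> intble (fun x => f x - g x).
Proof. by move=> fi gi; exact: (integrableB measurableT fi gi). Qed.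

Lemma intble_cst c : intble (fun=> c).
Proof. exact: finite_measure_integrable_cst. Qed.

Lemma Rintegral_cstT (c : R) : \int[P]_x c = c.
Proof.
rewrite Rintegral_cst//; transitivity (c * fine 1%E); last by rewrite mulr1.
by congr (_ * fine _); exact: probability_setT.
Qed.

Lemma intble_le f g : measurable_fun setT f -> (forall x, `|f x| <= g x) ->
  intble g -> intble f.
Proof.
move=> mf fg gi; apply: le_integrable gi => //; first exact/measurable_EFinP.
by move=> x _ /=; rewrite lee_fin (le_trans (fg x))// ler_norm.
Qed.

Lemma intble_max0 f : intble f -> intble (fun x => Num.max 0 (f x)).
Proof.
move=> fi; apply: (@intble_le _ (fun x => `|f x|)).
- by apply: measurable_maxr => //; exact: intble_measurable.
- by move=> x; rewrite ger0_norm ?le_max ?lexx// ge_max normr_ge0 ler_norm.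
- exact: integrable_norm.
Qed.

Lemma intbleS A f : measurable A -> intble f -> P.-integrable A (EFin \o f).
Proof. by move=> mA fi; apply: integrableS fi. Qed.

Lemma intble_restrict A f : measurable A -> intble f -> intble (f \_ A).
Proof.
move=> mA fi; apply: (@intble_le _ (fun x => `|f x|)).
- apply: (measurable_restrictT f mA).1.
  by apply: measurable_funTS; exact: intble_measurable fi.
- by move=> x; rewrite patchE; case: ifP => //; rewrite normr0.
- exact: integrable_norm.
Qed.

Lemma intble_sum n (f : nat -> T -> R) :
  (forall k, intble (f k)) -> intble (fun x => \sum_(k < n) f k x).
Proof.
move=> fi; elim: n => [|n IHn].
  by under [X in intble X]eq_fun do rewrite big_ord0; exact: intble_cst.
by under [X in intble X]eq_fun do rewrite big_ord_recr; exact: intbleD.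
Qed.

Lemma integral_setC A f : measurable A -> intble f ->
  \int[P]_x f x = \int[P]_(x in A) f x + \int[P]_(x in ~` A) f x.
Proof.
move=> mA fi; rewrite -Rintegral_setU ?setUv//; first exact: measurableC.
by apply/disj_set2P; rewrite setICr.
Qed.

Lemma integral_vanish (h : T -> R) (A : nat -> set T) (e : R) :
  intble h -> (forall x, 0 <= h x) -> (forall n, measurable (A n)) ->
  (forall n, A n.+1 `<=` A n) -> P (\bigcap_n A n) = 0%E -> 0 < e ->
  exists N, forall n, (N <= n)%N -> \int[P]_(x in A n) h x <= e.
Proof.
move=> hi h0 mA decA PA e0.
have decAn m n : (m <= n)%N -> A n `<=` A m.
  move=> /subnK <-; elim: (n - m)%N => // k IHk.
  by rewrite addSn; apply: subset_trans IHk.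
have [|||||_ _] := @dominated_convergence _ T R P setT measurableT
  (fun n => EFin \o (h \_ (A n))) (cst 0%E) (EFin \o h).
- by move=> n; apply/measurable_EFinP/intble_measurable/intble_restrict.
- exact: measurable_cst.
- exists (\bigcap_n A n); split => //; first exact: bigcapT_measurable.
  move=> x /= /not_implyP[_ ncv] n _; apply: contrapT => nAx; apply: ncv.
  apply: cvg_near_cst; exists n => // m /= nm.
  by rewrite patchE memNset// => /(decAn _ _ nm).
- exact: hi.
- apply: aeW => x n _ /=; rewrite patchE; case: ifP => _; rewrite ?normr0 lee_fin//.
  by rewrite ger0_norm.
rewrite integral0 => /fine_cvgP[_ /cvgrPdist_le/(_ e e0)[N _ HN]].
exists N => n Nn; have := HN n Nn; rewrite /= sub0r normrN.
rewrite (_ : fine _ = \int[P]_(x in A n) h x); last by rewrite Rintegral_mkcond.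
exact/le_trans/ler_norm.
Qed.

End integrability.

Section maximal.
Context d (T : measurableType d) (R : realType) (P : probability T R).
Variable S : T -> T.
Hypothesis mS : measurable_fun [set: T] S.
Hypothesis PS : forall F, measurable F -> P (S @^-1` F) = P F.
Notation intble := (intble P).

Lemma intble_comp (f : T -> R) : intble f -> intble (f \o S).
Proof. exact: (integrable_transfer mS PS). Qed.

Lemma Rintegral_comp (f : T -> R) : intble f ->
  \int[P]_x f (S x) = \int[P]_x f x.
Proof. by move=> fi; rewrite -(Rintegral_transfer mS PS). Qed.

Section garsia.
Variable b : nat -> T -> R.
Hypothesis bi : forall n, intble (b n).

(** Unrolled, this is the maximum over [k <= n] of the sums of [b (n - j - 1) (S^j x)] over [j < k].
    The index of [b] counts the remaining time, which lets [b] be built from the increments of a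
    subadditive cocycle. *)
Fixpoint garsia_max n x : R :=
  if n is n'.+1 then Num.max 0 (b n' x + garsia_max n' (S x)) else 0.

Definition garsia_set n : set T := [set x | 0 < b n x + garsia_max n (S x)].

Lemma garsia_max_ge0 n x : 0 <= garsia_max n x.
Proof. by case: n => //= n; rewrite le_max lexx. Qed.

Lemma intble_garsia_max n : intble (garsia_max n).
Proof.
elim: n => [|n IHn]; first exact: intble_cst.
by apply: intble_max0; apply: intbleD => //; exact: intble_comp.
Qed.

Lemma measurable_garsia_set n : measurable (garsia_set n).
Proof.
have m : measurable_fun setT (fun x => b n x + garsia_max n (S x)).
  by apply: intble_measurable; apply: intbleD => //; apply: intble_comp;
    exact: intble_garsia_max.
have -> : garsia_set n = setT `&` (fun x => b n x + garsia_max n (S x)) @^-1` `]0, +oo[.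
  by rewrite setTI; apply/seteqP; split => x; rewrite /= in_itv/= andbT.
by apply: m.
Qed.

(** On [garsia_set n] the new maximum is [b n] plus the old one at [S x]; off it the new maximum is
    0. After integration, the invariance of [P] turns the old maximum at [S x] into the one at
    [x]. *)
Lemma garsia_ineq n :
  \int[P]_x garsia_max n.+1 x - \int[P]_x garsia_max n x <=
  \int[P]_(x in garsia_set n) b n x.
Proof.
have mG := measurable_garsia_set n.
rewrite -(Rintegral_comp (intble_garsia_max n)) -RintegralB//; last 2 first.
- exact: intble_garsia_max.
- by apply: intble_comp; exact: intble_garsia_max.
rewrite [leRHS]Rintegral_mkcond; apply: le_Rintegral => //.
- by apply: intbleB; [|apply: intble_comp]; exact: intble_garsia_max.
- exact: intble_restrict.
move=> x _; rewrite patchE; case: ifPn => [|].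
  by rewrite inE /garsia_set /= => /ltW/max_idPr ->; rewrite addrK.
rewrite notin_setE /garsia_set /= => /negP; rewrite -leNgt => /max_idPl ->.
by rewrite sub0r oppr_le0 garsia_max_ge0.
Qed.

(** When [b] varies with [n] the maxima need not increase, so it is the telescoping sum over [n],
    not each term, that has a sign. *)
Lemma garsia_sum N : 0 <= \sum_(n < N) \int[P]_(x in garsia_set n) b n x.
Proof.
have h : \int[P]_x garsia_max N x <= \sum_(n < N) \int[P]_(x in garsia_set n) b n x.
  elim: N => [|N IHN]; first by rewrite big_ord0 Rintegral_cst// mul0r.
  by rewrite big_ord_recr/=; have := garsia_ineq N; lra.
by apply: le_trans h; apply: Rintegral_ge0 => x _; exact: garsia_max_ge0.
Qed.

Lemma sum_le_garsia_max n k x : (k <= n)%N ->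
  \sum_(j < k) b (n - j.+1)%N (iter j S x) <= garsia_max n x.
Proof.
elim: n k x => [|n IHn] [|k] x //=; rewrite ?big_ord0//.
  by move=> _; rewrite le_max lexx.
rewrite ltnS => kn; rewrite big_ord_recl/= subn1/= le_max.
apply/orP; right; rewrite lerD2l; apply: le_trans (IHn k _ kn).
by apply: ler_sum => j _; rewrite /bump/= add1n subSS -iterSr.
Qed.

Lemma notin_garsia_set n x : ~ garsia_set n x -> garsia_max n.+1 x = 0.
Proof. by rewrite /garsia_set /= => /negP; rewrite -leNgt => /max_idPl. Qed.

(* Off [garsia_set n], every sum of b (n - j) (S^j x) over j < k with k <= n + 1
   is nonpositive; taking b n = a - (u (n + 1) - u n o S) for a subadditive
   cocycle u gives the lemma of Karlsson and Margulis. *)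
Lemma leaders (H : T -> R) (e : R) :
  intble H -> (forall x, 0 <= H x) -> 0 < e ->
  (forall n x, - b n x <= H x) ->
  (forall N, \sum_(n < N) \int[P]_x b n x <= - (N%:R * e)) ->
  (0 < P (lim_sup_set (fun n => ~` garsia_set n)))%E.
Proof.
move=> Hi H0 e0 bH be.
have mG n : measurable (~` garsia_set n).
  by apply: measurableC; exact: measurable_garsia_set.
(* If the upper limit is null, the integral of [H] off [garsia_set n] is at most [e / 2] from some
   [N] on. It bounds the excess of the integral of [b n] over [garsia_set n] above the full one.
   Summed over [n < M], this gives M e <= N E(H) + M e / 2, which fails for large [M]. *)
rewrite lt0e measure_ge0 andbT; apply/negP => /eqP P0.
pose A n := \bigcup_(k in [set k | (n <= k)%N]) ~` garsia_set k.
have mA n : measurable (A n) by apply: bigcup_measurable.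
have [|||N HN] := @integral_vanish _ _ _ P H A (e / 2) Hi H0 mA.
- move=> n x [k /= nk kx]; exists k => //=; exact: ltnW.
- rewrite -P0; congr (P _); apply/seteqP; split => [x h n _|x h n _]; exact: h.
- by rewrite divr_gt0.
have EH0 : 0 <= \int[P]_x H x by apply: Rintegral_ge0.
have HC n : \int[P]_(x in ~` garsia_set n) H x <= \int[P]_x H x.
  rewrite Rintegral_mkcond; apply: le_Rintegral => //.
    exact: intble_restrict.
  by move=> x _; rewrite patchE; case: ifP.
have HA n : (N <= n)%N -> \int[P]_(x in ~` garsia_set n) H x <= e / 2.
  move=> Nn; apply: le_trans (HN n Nn).
  rewrite [leLHS]Rintegral_mkcond [leRHS]Rintegral_mkcond.
  apply: le_Rintegral => //; [exact: intble_restrict..|].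
  move=> x _; rewrite !patchE; case: ifPn; rewrite ?inE ?notin_setE => hx.
    by rewrite mem_set//; exists n => /=.
  by case: ifP.
have low n : \int[P]_(x in garsia_set n) b n x - \int[P]_x b n x <=
    \int[P]_(x in ~` garsia_set n) H x.
  rewrite (integral_setC (measurable_garsia_set n) (bi n)).
  rewrite opprD addrA subrr sub0r.
  rewrite -[leLHS]mulN1r -RintegralZl//; last exact: intbleS.
  apply: le_Rintegral => //; last by move=> x _; rewrite mulN1r.
  + by rewrite (_ : EFin \o _ = fun x => (-1)%:E * (b n x)%:E)%E;
      [apply: integrableZl => //; exact: intbleS|apply/funext => x; rewrite /= EFinM].
  + exact: intbleS.
have up M : \sum_(n < M) \int[P]_(x in ~` garsia_set n) H x <=
    N%:R * \int[P]_x H x + M%:R * (e / 2).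
  elim: M => [|M IHM].
    by rewrite big_ord0 mul0r addr0 mulr_ge0.
  rewrite big_ord_recr/= -natr1 mulrDl mul1r.
  have [NM|MN] := leqP N M; first by have := HA M NM; lra.
  have : \sum_(n < M.+1) \int[P]_(x in ~` garsia_set n) H x <= N%:R * \int[P]_x H x.
    apply: le_trans (_ : \sum_(n < M.+1) \int[P]_x H x <= _); first exact: ler_sum.
    by rewrite sumr_const card_ord -[leLHS]mulr_natl; apply: ler_wpM2r => //; rewrite ler_nat.
  have : 0 <= M%:R * (e / 2) by rewrite mulr_ge0// divr_ge0// ltW.
  by rewrite big_ord_recr/=; lra.
have key M : M%:R * (e / 2) <= N%:R * \int[P]_x H x.
  have := up M; have := garsia_sum M; have := be M.
  have : \sum_(n < M) (\int[P]_(x in garsia_set n) b n x - \int[P]_x b n x) <=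
    \sum_(n < M) \int[P]_(x in ~` garsia_set n) H x by exact: ler_sum.
  by rewrite big_split/= sumrN; lra.
have := key (Num.bound (N%:R * \int[P]_x H x / (e / 2))).
have := archi_boundP (divr_ge0 (mulr_ge0 (ler0n R N) EH0) (divr_ge0 (ltW e0) (ler0n R 2))).
by rewrite ltr_pdivrMr ?divr_gt0//; lra.
Qed.

End garsia.

Lemma maximal_ineq (h : T -> R) (e : R) : intble h -> (forall x, 0 <= h x) -> 0 < e ->
  exists B, [/\ measurable B, (P B <= (\int[P]_x h x / e)%:E)%E &
    forall x, ~ B x -> forall n, \sum_(j < n) h (iter j S x) <= n%:R * e].
Proof.
move=> hi h0 e0.
pose b (n : nat) x := h x - e.
have bi n : intble (b n) by apply: intbleB => //; exact: intble_cst.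
have mG := measurable_garsia_set bi.
exists (\bigcup_n garsia_set b n); split.
- exact: bigcupT_measurable.
(* With [b] independent of [n] the maxima increase, hence so do the sets, and the bound for each of
   them passes to their union. *)
- have mono n x : garsia_max b n x <= garsia_max b n.+1 x.
    elim: n x => [|n IHn] x; first exact: garsia_max_ge0.
    by rewrite /= ge_max !le_max lexx/= lerD2l (IHn (S x)) orbT.
  have ndG : nondecreasing_seq (garsia_set b).
    apply/nondecreasing_seqP => n; apply/subsetPset => x; rewrite /garsia_set/=.
    by move=> /lt_le_trans; apply; rewrite lerD2l; exact: mono.
  have cv := nondecreasing_cvg_mu (mu := P) mG (bigcupT_measurable _ mG) ndG.
  rewrite -(cvg_lim _ cv)//; apply: lime_le; first by apply/cvg_ex; eexists; exact: cv.
  apply: nearW => n /=.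
  rewrite -(@fineK _ (P _)) ?fin_num_measure// lee_fin ler_pdivlMr//.
  have := garsia_ineq bi n.
  have : \int[P]_x garsia_max b n x <= \int[P]_x garsia_max b n.+1 x.
    by apply: le_Rintegral => //; exact: intble_garsia_max.
  rewrite /b RintegralB//; [|exact: intbleS|by apply: intbleS => //; exact: intble_cst].
  rewrite Rintegral_cst//.
  have : \int[P]_(x in garsia_set b n) h x <= \int[P]_x h x.
    rewrite Rintegral_mkcond; apply: le_Rintegral => //.
      exact: intble_restrict.
    by move=> x _; rewrite patchE; case: ifP.
  by rewrite /b; lra.
- move=> x nB [|n]; first by rewrite big_ord0 mul0r.
  have nG : ~ garsia_set b n x by move=> hG; apply: nB; exists n.
  have := @sum_le_garsia_max b n.+1 n.+1 x (leqnn _).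
  rewrite (notin_garsia_set nG) /b big_split/= sumrN sumr_const card_ord.
  by rewrite -mulr_natl; lra.
Qed.

(* [L x r] stands for [f x <= r] with [f] valued in [0, +oo]. *)
Lemma sublinear (L : T -> R -> Prop) (h : T -> R) :
  intble h -> (forall x, 0 <= h x) ->
  (forall r, measurable [set x | L x r]) ->
  (forall x r s, r <= s -> L x r -> L x s) ->
  (forall x r, L x r -> L (S x) (r + h x)) ->
  {ae P, forall x, (exists r, L x r) -> forall e, 0 < e ->
    exists K, forall k, (K <= k)%N -> L (iter k S x) (k%:R * e)}.
Proof.
move=> hi h0 mL monoL LS.
pose fin := \bigcup_(n : nat) [set x | L x n%:R].
have mfin : measurable fin by exact: bigcupT_measurable.
have finP x r : L x r -> fin x.
  move=> Lx; exists (Num.bound (Num.max 0 r)) => //=; apply: monoL Lx.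
  by apply/ltW/(le_lt_trans _ (archi_boundP _)); rewrite le_max lexx ?orbT.
(* Whenever f is at most [C] at the next point, the past growth can be forgotten. So only the
   increments of [h] at points of [A C] count, and their mean vanishes as [C] grows. *)
pose A (C : nat) := S @^-1` (fin `\` [set x | L x C%:R]).
have mA C : measurable (A C).
  by rewrite -[A C]setTI; apply: mS => //; exact: measurableD.
have cA : \bigcap_C A C = set0.
  rewrite -subset0 => x Ax; have [[n _ Ln] _] := Ax 0%N I.
  by have [_] := Ax n I.
have vanish := integral_vanish hi h0 mA.
have step (i : nat) : exists B, [/\ measurable B, P B = 0%E & forall x, ~ B x ->
    (exists r, L x r) -> exists K, forall k, (K <= k)%N -> L (iter k S x) (k%:R * i.+1%:R^-1)].
  (* Half of the tolerance pays for the initial value [r0], the other half for the sum of the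
     truncated increments. *)
  pose e : R := i.+1%:R^-1 / 2.
  have e0 : 0 < e by rewrite divr_gt0// invr_gt0.
  have /choice[B HB] (j : nat) : exists B : set T, [/\ measurable B,
      (P B <= (j.+1%:R^-1)%:E)%E & forall x, ~ B x ->
      (exists r, L x r) -> exists K, forall k, (K <= k)%N -> L (iter k S x) (k%:R * i.+1%:R^-1)].
    (* The maximal inequality divides this integral by [e], which leaves an exceptional set of
       probability at most 1/(j+1). *)
    have [|||N HN] := vanish (e * j.+1%:R^-1).
    - move=> n x [h1 h2]; split => //; apply: contra_not h2; apply: monoL.
      by rewrite ler_nat.
    - by rewrite cA measure0.
    - by rewrite mulr_gt0// invr_gt0.
    pose hC := h \_ (A N).
    have hC0 x : 0 <= hC x by rewrite /hC patchE; case: ifP.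
    have [B [mB PB HB]] := maximal_ineq (intble_restrict (mA N) hi) hC0 e0.
    exists B; split => //.
      apply: (le_trans PB); rewrite lee_fin ler_pdivrMr// mulrC.
      by rewrite -Rintegral_mkcond; exact: HN.
    move=> x nBx [r Lr].
    pose r0 := Num.max N%:R r.
    have Lk k : L (iter k S x) (r0 + \sum_(j < k) hC (iter j S x)).
      elim: k => [|k IHk].
        by rewrite big_ord0 addr0; apply: monoL Lr; rewrite le_max lexx orbT.
      have [LN|nLN] := pselect (L (iter k.+1 S x) N%:R).
        apply: monoL LN; rewrite -[leLHS]addr0 lerD ?le_max ?lexx//.
        by apply: sumr_ge0.
      rewrite big_ord_recr/= addrA.
      suff -> : hC (iter k S x) = h (iter k S x) by exact: LS.
      rewrite /hC patchE mem_set//; split => //; exact: finP (LS _ _ IHk).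
    exists (Num.bound (Num.max 0 (r0 / e))) => k Kk; apply: monoL (Lk k).
    have := HB x nBx k; rewrite /hC.
    have : r0 <= k%:R * e.
      rewrite -ler_pdivrMr//; apply: le_trans (_ : (Num.bound (Num.max 0 (r0 / e)))%:R <= _).
        by apply/ltW/(le_lt_trans _ (archi_boundP _)); rewrite le_max lexx ?orbT.
      by rewrite ler_nat.
    by rewrite /e; set c := i.+1%:R^-1; nra.
  exists (\bigcap_j B j); split.
  - by apply: bigcapT_measurable => j; have [] := HB j.
  - apply/eqP; rewrite eq_le measure_ge0 andbT.
    apply/lee_addgt0Pr => e' e'0; rewrite add0e.
    have [j _ Hj] := near_infty_natSinv_lt (PosNum e'0).
    have [mB PB _] := HB j.
    apply: (le_trans (le_measure P _ _ (_ : \bigcap_j B j `<=` B j))); rewrite ?inE//.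
    + by apply: bigcapT_measurable => k; have [] := HB k.
    + exact: bigcap_inf.
    + apply: (le_trans PB); rewrite lee_fin ltW//.
      by have := Hj j (leqnn j).
  - move=> x /existsNP[j /not_implyP[_ nB]]; have [_ _] := HB j; exact.
have /choice[B HB] := step.
exists (\bigcup_i B i); split.
- by apply: bigcupT_measurable => i; have [] := HB i.
- apply/negligibleP; first by apply: bigcupT_measurable => i; have [] := HB i.
  by apply: negligible_bigcup => i; apply/negligibleP; have [] := HB i.
- move=> x /= nx; apply: contrapT => nBx; apply: nx => ex e e0.
  have [i _ Hi] := near_infty_natSinv_lt (PosNum e0).
  have [_ _ /(_ x)] := HB i.
  have nBix : ~ B i x by move=> Bi; apply: nBx; exists i.
  move=> /(_ nBix ex)[K HK]; exists K => k Kk; apply: monoL (HK k Kk).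
  by rewrite ler_wpM2l// ltW//; have := Hi i (leqnn i).
Qed.

End maximal.

(** * Geodesics in a stably visible space *)

Lemma fmap_ultra (T U : Type) (f : T -> U) (F : set_system T) :
  UltraFilter F -> UltraFilter (f x @[x --> F]).
Proof.
move=> FU; split; first exact: fmap_proper_filter.
move=> G GF fFG; apply/seteqP; split; last exact: fFG.
move=> A GA; have [//|FnA] := in_ultra_setVsetC (f @^-1` A) FU.
have GnA : G (~` A) by exact: fFG.
by have [x []] := filter_ex (filterI GA GnA).
Qed.

(** * Cluster points and limits of sequences *)

Section topology.
Context {Xbar : topologicalType}.

(** [W n] is the finite intersection of the basic neighbourhoods of [p] with code at most [n]. The
    times [phi n] need not increase; [n <= phi n] is enough for limits to be inherited. *)
Lemma cluster_subsequence (u : nat -> Xbar) p : @second_countable Xbar ->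
  cluster (u @ \oo) p ->
  exists phi : nat -> nat, (forall n, (n <= phi n)%N) /\ u (phi n) @[n --> \oo] --> p.
Proof.
move=> [B + [oB bB]] clu => cB.
have /pcard_injP[f finj] := cB.
have freq V N : nbhs p V -> exists n, (N <= n)%N /\ V (u n).
  move=> nV.
  have [|_ [[n [Nn ->]] Vn]] := clu [set q | exists n, (N <= n)%N /\ q = u n] V _ nV.
    by exists N => // n Nn; exists n.
  by exists n.
pose W n := \bigcap_(V in [set V | B V /\ V p /\ (f V <= n)%N]) V.
have nW n : nbhs p (W n).
  have -> : W n = \bigcap_(k in [set k | (k < n.+1)%N])
     \bigcap_(V in [set V | B V /\ V p /\ f V = k]) V.
    apply/seteqP; split => [q h k kn V [BV [Vp fV]]|q h V [BV [Vp fV]]].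
      by apply: h; split => //; split=> //; rewrite fV.
    by apply: (h (f V)) => //; rewrite /= ltnS.
  rewrite bigcap_mkord; apply: big_ind => [|U V|k _]; first exact: filterT.
    exact: filterI.
  have [[V [BV [Vp fV]]]|nex] := pselect (exists V, B V /\ V p /\ f V = k).
    rewrite (_ : bigcap _ _ = V); first by apply: open_nbhs_nbhs; split => //; exact: oB.
    apply/seteqP; split => [q|q Vq U [BU [Up fU]]]; first by apply.
    by rewrite (_ : U = V)//; apply: finj; rewrite ?inE// fU.
  rewrite (_ : bigcap _ _ = setT); first exact: filterT.
  by rewrite -subTset => q _ V hV; case: nex; exists V.
have /choice[phi Hphi] := fun n => freq (W n) n (nW n).
exists phi; split => [n|]; first by case: (Hphi n).
move=> /= V /bB[U [BU Up] UV].
exists (f U) => // n /= fn; apply: UV.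
by have [_] := Hphi n; apply.
Qed.

Lemma compact_cluster_cvg (u : nat -> Xbar) p : hausdorff_space Xbar ->
  compact [set: Xbar] -> (forall q, cluster (u @ \oo) q -> q = p) ->
  u n @[n --> \oo] --> p.
Proof.
move=> hX cX uniq.
apply: (@compact_cluster_set1 _ p (u @ \oo) setT) => //.
- exact: filterT.
- exact: filterT.
apply/seteqP; split => [q /uniq->//|_ ->].
have [q [_ clq]] := cX (u @ \oo) _ filterT.
by rewrite -(uniq q clq).
Qed.

End topology.

Section geometry.
Context {R : realType} {X : metricType R} {Xbar : topologicalType}.
Variable iota : X -> Xbar.

(** Geodesics are not unique; quantifying over all of them makes the condition depend on the three
    points alone and invariant under the action. *)
Definition near_geodesics (x y z : X) (r : R) : Prop :=
  forall a b gamma, geodesic_segment a b y z gamma ->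
    exists2 t, t \in `[a, b] & mdist x (gamma t) <= r.

Lemma near_geodesics_le x y z r s : r <= s ->
  near_geodesics x y z r -> near_geodesics x y z s.
Proof.
move=> rs h a b gamma /h[t tab xt]; exists t => //; exact: le_trans rs.
Qed.

Lemma near_geodesics_move x x' y z r : near_geodesics x y z r ->
  near_geodesics x' y z (r + mdist x' x).
Proof.
move=> h a b gamma /h[t tab xt]; exists t => //.
by have := metric_triangle x' x (gamma t); lra.
Qed.

Lemma near_geodesics_endl x z : near_geodesics x x z 0.
Proof.
move=> a b gamma [ab _ <- _]; exists a; first by rewrite in_itv/= lexx.
by rewrite mdistxx.
Qed.

Lemma geodesic_length a b x y gamma : @geodesic_segment R X a b x y gamma ->
  mdist x y = b - a.
Proof.
move=> [ab iso <- <-]; rewrite iso/= ?in_itv/= ?lexx ?ab//.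
by rewrite distrC ger0_norm// subr_ge0.
Qed.

Lemma geodesic_from0 : geodesic_space X -> forall x y : X,
  exists gamma, geodesic_segment 0 (mdist x y) x y gamma.
Proof.
move=> gX x y; have [a [b [gamma gab]]] := gX x y.
have l := geodesic_length gab; case: gab => ab iso ga gb.
exists (fun t => gamma (a + t)); split; first exact: mdist_ge0.
- move=> s t; rewrite /= !in_itv/= l => sI tI; rewrite iso/= ?in_itv/=; [|lra|lra].
  by congr (`| _ |); lra.
- by rewrite addr0.
- by rewrite l -gb; congr gamma; lra.
Qed.

Lemma geodesic_dist0 x y b gamma t : @geodesic_segment R X 0 b x y gamma ->
  0 <= t <= b -> mdist x (gamma t) = t.
Proof.
move=> [b0 iso <- _] tb; rewrite iso/= ?in_itv/= ?lexx//.
by rewrite sub0r normrN ger0_norm//; case/andP: tb.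
Qed.

Definition to_infinity (x : X) (u : nat -> X) : Prop :=
  forall r : R, exists N, forall n, (N <= n)%N -> r < mdist x (u n).

Lemma to_infinity_comp x u (phi : nat -> nat) : to_infinity x u ->
  (forall n, (n <= phi n)%N) -> to_infinity x (u \o phi).
Proof.
move=> ux phin r; have [N HN] := ux r; exists N => n Nn /=.
exact/HN/(leq_trans Nn).
Qed.

(** Around a point [z] of [X], some open set of [Xbar] meets [X] only inside the unit ball of [z],
    which [u] eventually leaves. *)
Lemma cluster_boundary x u p : homeo_onto_image iota -> to_infinity x u ->
  cluster (iota (u n) @[n --> \oo]) p -> boundary iota p.
Proof.
move=> [_ _ openi] ux clp [z _ zp].
have [V oV Vball] := openi _ (open_interior (ball z 1)).
have Vp : nbhs p V.
  apply: open_nbhs_nbhs; split => //; rewrite -zp.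
  suff : (iota @^-1` V) z by [].
  by rewrite -Vball; exact: nbhs_singleton (nbhs_interior (nbhsx_ballx z _ ltr01)).
have [N HN] := ux (mdist x z + 1).
have [|_ [[n [Nn ->]]]] := clp [set q | exists n, (N <= n)%N /\ q = iota (u n)] V _ Vp.
  by exists N => // n /= Nn; exists n.
move=> Vun; have : (iota @^-1` V) (u n) by [].
rewrite -Vball => /interior_subset; rewrite ballEmdist/= => zu.
by have := HN n Nn; have := metric_triangle x z (u n); lra.
Qed.

(** The last hypothesis says that the Gromov products at [x] are unbounded. If the limits differed,
    a bounded set would meet every geodesic from [v n] to [u n], and a point [q] on the geodesic
    bounds the Gromov product by d(x, q). *)
Lemma unique_limit x (u v : nat -> X) xi eta :
  geodesic_space X -> stably_visible iota ->
  boundary iota xi -> iota (u n) @[n --> \oo] --> xi ->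
  boundary iota eta -> iota (v n) @[n --> \oo] --> eta ->
  (forall r : R, exists n, r < mdist x (u n) + mdist x (v n) - mdist (u n) (v n)) ->
  eta = xi.
Proof.
move=> gX sv bxi uxi beta veta far; apply: contrapT => neq.
have /choice[gamma Hg] := fun n => geodesic_from0 gX (v n) (u n).
have [B [z [r Br]] HB] := sv _ _ _ _ _ _ _ Hg bxi uxi beta veta neq.
have [n] := far (2 * (mdist x z + r)).
have [q [Bq [t tI gt]]] := HB n.
have [ab iso g0 gd] := Hg n.
have := Br q Bq; have := metric_triangle x z q; have := metric_triangle x q (u n).
have := metric_triangle x q (v n).
have -> : mdist q (u n) = mdist (v n) (u n) - t.
  rewrite -gt -{1}gd iso//=; last by rewrite in_itv/= lexx ab.
  rewrite distrC ger0_norm// subr_ge0.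
  by move: tI; rewrite /= in_itv/= => /andP[].
have -> : mdist q (v n) = t.
  by rewrite metric_sym -gt; apply: geodesic_dist0 (Hg n) _; move: tI; rewrite /= in_itv.
rewrite (metric_sym (v n)).
lra.
Qed.

Lemma drift_converges (x : nat -> X) (delta : R) :
  geodesic_space X -> stably_visible iota -> homeo_onto_image iota ->
  hausdorff_space Xbar -> @second_countable Xbar -> compact [set: Xbar] ->
  0 < delta ->
  (forall m, exists n, (m <= n)%N /\ forall k, (k <= n)%N ->
    delta * k%:R + mdist (x k) (x n) <= mdist (x 0%N) (x n)) ->
  exists2 xi, boundary iota xi & iota (x n) @[n --> \oo] --> xi.
Proof.
move=> gX sv hi hX scX cX d0 /choice[phi Hphi].
have drift k : delta * k%:R <= mdist (x 0%N) (x k).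
  have [kp /(_ k kp)] := Hphi k.
  by have := metric_triangle (x 0%N) (x k) (x (phi k)); lra.
have arch r : exists N, forall n, (N <= n)%N -> r < delta * n%:R.
  exists (Num.bound (Num.max 0 (r / delta))) => n Nn.
  rewrite mulrC -ltr_pdivrMr//.
  apply: (@le_lt_trans _ _ (Num.max 0 (r / delta))); first by rewrite le_max lexx orbT.
  apply: lt_le_trans (archi_boundP _) _; first by rewrite le_max lexx.
  by rewrite ler_nat.
have inf : to_infinity (x 0%N) x.
  move=> r; have [N HN] := arch r; exists N => n /HN; have := drift n; lra.
have [p [_ clp]] := cX (iota (x (phi n)) @[n --> \oo]) _ filterT.
have [psi [psin cvp]] := cluster_subsequence scX clp.
have bp : boundary iota p.
  apply: cluster_boundary clp => //.
  by apply: to_infinity_comp inf _ => n; case: (Hphi n).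
exists p => //; apply: compact_cluster_cvg => // q clq.
have [chi [chin cvq]] := cluster_subsequence scX clq.
(* [phi (psi (chi n))] is a good time beyond [chi n], so twice the Gromov product of the two points
   is at least [2 * delta * chi n]; hence [r / 2] below. *)
apply: (@unique_limit (x 0%N) (fun n => x (phi (psi (chi n)))) (fun n => x (chi n))) => //.
- move=> V /cvp[N _ HN]; exists N => // n /= Nn; apply: HN => /=.
  exact: leq_trans Nn (chin n).
- by apply: cluster_boundary clq.
- move=> r; have [N HN] := arch (r / 2); exists N.
  have [phin /(_ (chi N))] := Hphi (psi (chi N)).
  rewrite metric_sym => /(_ (leq_trans (psin _) phin)).
  have := HN _ (chin N); have := drift (chi N); lra.
Qed.

(** Otherwise, for each [i], some geodesic between the two sequences stays farther than [i] from
    [o]. So do its endpoints, hence their indices tend to infinity and they converge to [eta] and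
    [xi]. The bounded set given by visibility is then contradicted. *)
Lemma near_bounded o (x y : nat -> X) xi eta :
  stably_visible iota ->
  boundary iota xi -> iota (x n) @[n --> \oo] --> xi ->
  boundary iota eta -> iota (y n) @[n --> \oo] --> eta ->
  eta <> xi ->
  exists C, forall m n, near_geodesics o (y m) (x n) C.
Proof.
move=> sv bxi cxi beta ceta neq; apply: contrapT => nC.
have /choice[f Hf] (i : nat) : exists p : nat * nat * R * R * (R -> X),
    geodesic_segment p.1.1.2 p.1.2 (y p.1.1.1.1) (x p.1.1.1.2) p.2 /\
    forall t, t \in `[p.1.1.2, p.1.2] -> i%:R < mdist o (p.2 t).
  apply: contrapT => /forallNP h; apply: nC; exists i%:R => m n a b gamma gab.
  apply: contrapT => hh; apply: (h (m, n, a, b, gamma)); split => //= t tab.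
  by rewrite ltNge; apply/negP => le; apply: hh; exists t.
have escape (z : nat -> X) (ind : nat -> nat) :
    (forall i, i%:R < mdist o (z (ind i))) ->
    forall N, exists I, forall i, (I <= i)%N -> (N <= ind i)%N.
  move=> hz N; pose s := \sum_(n < N) mdist o (z n).
  exists (Num.bound s) => i si; rewrite leqNgt; apply/negP => iN.
  have := hz i; apply/negP; rewrite -leNgt; apply: (@le_trans _ _ s).
    rewrite /s (bigD1 (Ordinal iN))//= lerDl; apply: sumr_ge0 => *; exact: mdist_ge0.
  have := archi_boundP (_ : 0 <= s).
  rewrite /s sumr_ge0; last by move=> *; exact: mdist_ge0.
  by move=> /(_ isT)/ltW/le_trans; apply; rewrite ler_nat.
have esc_cvg (z : nat -> X) ind (p : Xbar) : (forall i, i%:R < mdist o (z (ind i))) ->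
    iota (z n) @[n --> \oo] --> p -> iota (z (ind i)) @[i --> \oo] --> p.
  move=> hz cz V /cz[N _ HN]; have [I HI] := escape z ind hz N.
  by exists I => // i /= /HI; exact: HN.
have fx i : i%:R < mdist o (x (f i).1.1.1.2).
  have [[ab _ _ <-] h] := Hf i; apply: h.
  by rewrite in_itv/= lexx ab.
have fy i : i%:R < mdist o (y (f i).1.1.1.1).
  have [[ab _ <- _] h] := Hf i; apply: h.
  by rewrite in_itv/= lexx ab.
have [B [z [r Br]] HB] := sv _ _ _ _ _ _ _ (fun i => (Hf i).1)
  bxi (esc_cvg _ _ _ fx cxi) beta (esc_cvg _ _ _ fy ceta) neq.
pose i := Num.bound (mdist o z + `|r|).
have [q [Bq [t tI gt]]] := HB i.
have := (Hf i).2 t tI; rewrite gt; apply/negP; rewrite -leNgt.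
have zq := Br q Bq.
have := archi_boundP (_ : 0 <= mdist o z + `|r|).
rewrite addr_ge0// ?mdist_ge0// -/i => /(_ isT).
have := metric_triangle o z q; have := ler_norm r; lra.
Qed.

(** A single ultrafilter finer than the tail filter gives limits for all [t] at once, in place of
    the diagonal extraction of Arzela-Ascoli: for large [n], [g n t] lies in the compact ball of
    radius [t]. *)
Lemma limit_ray o (u : nat -> X) (g : nat -> R -> X) :
  proper_space X -> to_infinity o u ->
  (forall n, geodesic_segment 0 (mdist o (u n)) o (u n) (g n)) ->
  exists2 gamma, geodesic_ray gamma & forall t p r, 0 <= t ->
    (exists N, forall n, (N <= n)%N -> mdist p (g n t) <= r) ->
    mdist p (gamma t) <= r.
Proof.
move=> pX ux gg.
have [U [UU sU]] := ultraFilterLemma (eventually_filter : ProperFilter \oo).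
have evt t : exists N, forall n, (N <= n)%N -> t <= mdist o (u n).
  by have [N HN] := ux t; exists N => n /HN /ltW.
have exl (t : R) : exists p : X, 0 <= t -> g n t @[n --> U] --> p.
  have [t0|t0] := leP 0 t; last by exists o.
  have UB : (g n t @[n --> U]) [set y | mdist o y <= t].
    apply: sU; have [N HN] := evt t; exists N => // n /= Nn.
    by rewrite (geodesic_dist0 (gg n)) ?t0 ?HN.
  have := pX o t; rewrite compact_ultra => /(_ _ (fmap_ultra _ UU) UB)[p [_ gp]].
  by exists p.
have [gamma Hg] := choice exl.
have close t e : 0 <= t -> 0 < e -> U [set n | mdist (gamma t) (g n t) < e].
  move=> t0 e0; have := Hg t t0 _ (nbhsx_ballx (gamma t) e e0).
  by rewrite /= nbhs_filterE/= ballEmdist.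
exists gamma.
  move=> s t; rewrite /= !in_itv/= !andbT => s0 t0.
  apply/eqP; rewrite eq_le; apply/andP; split; apply/ler_addgt0Pr => e e0.
    have e2 : 0 < e / 2 by rewrite divr_gt0.
    have [Ns HNs] := evt s; have [Nt HNt] := evt t.
    have Us : U [set n | (maxn Ns Nt <= n)%N] by apply: sU; exists (maxn Ns Nt).
    have [n /= [[h1 h2]]] := filter_ex (filterI (filterI (close s _ s0 e2) (close t _ t0 e2)) Us).
    rewrite geq_max => /andP[/HNs hs /HNt ht].
    have [_ iso _ _] := gg n.
    have := iso s t; rewrite /= !in_itv/= s0 t0 hs ht => /(_ isT isT) <-.
    have := metric_triangle (gamma s) (g n s) (gamma t).
    have := metric_triangle (g n s) (g n t) (gamma t).
    by rewrite (metric_sym (g n t) (gamma t)); lra.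
  have e2 : 0 < e / 2 by rewrite divr_gt0.
  have [Ns HNs] := evt s; have [Nt HNt] := evt t.
  have Us : U [set n | (maxn Ns Nt <= n)%N] by apply: sU; exists (maxn Ns Nt).
  have [n /= [[h1 h2]]] := filter_ex (filterI (filterI (close s _ s0 e2) (close t _ t0 e2)) Us).
  rewrite geq_max => /andP[/HNs hs /HNt ht].
  have [_ iso _ _] := gg n.
  have := iso s t; rewrite /= !in_itv/= s0 t0 hs ht => /(_ isT isT) <-.
  have := metric_triangle (g n s) (gamma s) (g n t).
  have := metric_triangle (gamma s) (gamma t) (g n t).
  by rewrite (metric_sym (g n s) (gamma s)); lra.
move=> t p r t0 [N HN]; apply/ler_addgt0Pr => e e0.
have UN : U [set n | (N <= n)%N] by apply: sU; exists N.
have [n /= [h1 /HN h2]] := filter_ex (filterI (close t _ t0 e0) UN).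
have := metric_triangle p (g n t) (gamma t).
by rewrite (metric_sym (g n t) (gamma t)); lra.
Qed.

(** If [X] were bounded it would be compact by properness, its image would be closed, and density
    would leave no boundary. Geodesics to ever farther points then have a limit ray. *)
Lemma ray_exists : proper_space X -> geodesic_space X ->
  homeo_onto_image iota -> hausdorff_space Xbar ->
  dense (range iota) -> boundary iota !=set0 ->
  exists gamma, @geodesic_ray R X gamma.
Proof.
move=> pX gX [_ ci _] hX dI [p bp].
have [_ [_ [ o _ _]]] := dI setT (ex_intro _ p I) openT.
have /choice[y Hy] (n : nat) : exists y, n%:R < mdist o y.
  apply: contrapT => /forallNP h.
  have clI : closed (range iota).
    apply: compact_closed => //; rewrite (_ : [set: X] = [set y | mdist o y <= n%:R]).
      apply: continuous_compact; last exact: pX.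
      exact: continuous_subspaceT.
    by apply/seteqP; split => // y _ /=; rewrite leNgt; apply/negP.
  by have [q [bq rq]] := dI (boundary iota) (ex_intro _ p bp) (closed_openC clI).
have [g gg] := choice (fun n => geodesic_from0 gX o (y n)).
have [|gamma rg _] := limit_ray pX _ gg; last by exists gamma.
move=> r; exists (Num.bound (Num.max 0 r)) => n bn; apply: le_lt_trans (Hy n).
apply: (@le_trans _ _ (Num.max 0 r)); first by rewrite le_max lexx orbT.
by apply: (le_trans (ltW (archi_boundP _))); rewrite ?le_max ?lexx// ler_nat.
Qed.

Lemma tracking (x : nat -> X) (A : R) :
  proper_space X -> geodesic_space X -> 0 < A ->
  (forall e, 0 < e -> exists K, forall n, (K <= n)%N ->
    `|mdist (x 0%N) (x n) - A * n%:R| <= n%:R * e) ->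
  (forall e, 0 < e -> exists K, forall k, (K <= k)%N -> forall n, (k <= n)%N ->
    near_geodesics (x k) (x 0%N) (x n) (k%:R * e)) ->
  exists2 gamma, geodesic_ray gamma &
    mdist (x n) (gamma (A * n%:R)) / n%:R @[n --> \oo] --> (0 : R).
Proof.
move=> pX gX A0 speed near.
have [g gg] := choice (fun n => geodesic_from0 gX (x 0%N) (x n)).
have inf : to_infinity (x 0%N) x.
  move=> r; have A2 : 0 < A / 2 by rewrite divr_gt0.
  have [K HK] := speed _ A2.
  exists (maxn K (Num.bound (Num.max 0 (r / (A / 2))))) => n.
  rewrite geq_max => /andP[/HK + bn].
  have : r < n%:R * (A / 2).
    rewrite -ltr_pdivrMr//.
    apply: (@le_lt_trans _ _ (Num.max 0 (r / (A / 2)))); first by rewrite le_max lexx orbT.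
    apply: lt_le_trans (archi_boundP _) _; first by rewrite le_max lexx.
    by rewrite ler_nat.
  by rewrite ler_norml => rn /andP[h _]; nra.
have [gamma rg Hgamma] := limit_ray pX inf gg.
exists gamma => //.
apply/(@cvgrPdist_le _ R^o) => e e0.
have e3 : 0 < e / 3 by rewrite divr_gt0.
have [K1 HK1] := speed _ e3.
have [K2 HK2] := near _ e3.
exists (maxn 1 (maxn K1 K2)) => // k; rewrite /= !geq_max => /and3P[k1 /HK1 hs /HK2 hn].
have k0 : 0 < k%:R :> R by rewrite ltr0n.
rewrite sub0r normrN ger0_norm; last by rewrite divr_ge0// mdist_ge0.
rewrite ler_pdivrMr//.
pose ak := mdist (x 0%N) (x k).
have ak0 : 0 <= ak by exact: mdist_ge0.
(* One third reaches a point [g n s], one third moves from [s] to [ak], since [s] is the distance of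
   that point to [x 0]; the last third compares [ak] with [A * k]. *)
have near_ak : mdist (x k) (gamma ak) <= 2 * (k%:R * (e / 3)).
  apply: Hgamma => //.
  have [N HN] := inf ak; exists (maxn N k) => n; rewrite geq_max => /andP[/HN lt kn].
  have [s sI ds] := hn n kn _ _ _ (gg n).
  have [_ iso _ _] := gg n.
  have d0s : mdist (x 0%N) (g n s) = s by apply: geodesic_dist0 (gg n) _; move: sI; rewrite in_itv.
  have : mdist (g n s) (g n ak) = `|s - ak|.
    by apply: iso => //=; rewrite in_itv/= ak0 ltW.
  have : `|s - ak| <= k%:R * (e / 3).
    rewrite ler_norml; have := metric_triangle (x 0%N) (x k) (g n s).
    have := metric_triangle (x 0%N) (g n s) (x k).
    rewrite (metric_sym (g n s) (x k)) d0s -/ak; lra.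
  have := metric_triangle (x k) (g n s) (g n ak); lra.
have : mdist (gamma ak) (gamma (A * k%:R)) <= k%:R * (e / 3).
  rewrite rg//= in_itv/= andbT//.
  by rewrite mulr_ge0// ltW.
have := metric_triangle (x k) (gamma ak) (gamma (A * k%:R)); lra.
Qed.

End geometry.

(** * Drift of the random walk *)

Lemma ler_sum_prefix (R : numDomainType) (F : nat -> R) m n :
  (forall i, 0 <= F i) -> (m <= n)%N -> \sum_(i < m) F i <= \sum_(i < n) F i.
Proof.
move=> F0 mn; rewrite -(subnKC mn) big_split_ord/= lerDl.
by apply: sumr_ge0 => i _.
Qed.

Section walks.
Context {G : groupType}.
Notation GG := (discrete_group G).
Notation Omega := (increments G).

Lemma tailn_tailn m n (omega : Omega) : tailn m (tailn n omega) = tailn (n + m)%N omega.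
Proof. by apply/funext => i; exact: (congr1 omega (addnA n m i)). Qed.

Lemma tailn0 (omega : Omega) : tailn 0 omega = omega.
Proof. by []. Qed.

Lemma iter_tailn n p (omega : Omega) : iter n (tailn p) omega = tailn (p * n)%N omega.
Proof.
elim: n => [|n IHn]; first by rewrite muln0.
by rewrite iterS IHn tailn_tailn; congr (tailn _ omega); lia.
Qed.

Lemma iter_tailn1 k (omega : Omega) : iter k (tailn 1) omega = tailn k omega.
Proof. by rewrite iter_tailn mul1n. Qed.

Hypothesis cG : countable [set: G].

(** As [G] is countable, this is a countable union of events that fix both group elements, whatever
    [Z] says about geodesics or about [Xbar]. *)
Lemma measurable_rel d (T : measurableType d) (p q : T -> GG)
    (Z : G -> G -> Prop) :
  measurable_fun setT p -> measurable_fun setT q ->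
  measurable [set t | Z (p t) (q t)].
Proof.
move=> mp mq; have /pcard_injP[f finj] := cG.
pose fib n : set GG := [set g | f g = n].
have -> : [set t | Z (p t) (q t)] = \bigcup_n \bigcup_(m in
    [set m | exists g h : GG, [/\ f g = n, f h = m & Z g h]])
    (p @^-1` fib n `&` q @^-1` fib m).
  apply/seteqP; split => [t Zt|t [n _ [m [g [h [gn hm Zgh]]]] [/= pn qm]]].
    exists (f (p t)) => //; exists (f (q t)) => //=.
    by exists (p t), (q t).
  have -> : p t = g by apply: finj; rewrite ?inE// pn.
  by have -> : q t = h by apply: finj; rewrite ?inE// qm.
apply: bigcupT_measurable => n; apply: bigcup_measurable => m _.
by apply: measurableI; rewrite -[X in measurable X]setTI; [exact: mp|exact: mq].
Qed.

Lemma measurable_fun_G d (T : measurableType d) (p q : T -> GG)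
    d' (Y : measurableType d') (F : G -> G -> Y) :
  measurable_fun setT p -> measurable_fun setT q ->
  measurable_fun setT (fun t => F (p t) (q t)).
Proof.
move=> mp mq _ B mB; rewrite setTI.
exact: (measurable_rel (fun g h => B (F g h))).
Qed.

(** [phi] is the identity for the forward walk and inversion for the backward one. *)
Definition walk_by (phi : G -> G) (omega : Omega) (n : nat) : G :=
  (\prod_(i < n) phi (omega i : G))%g.

Lemma walk_by_id omega n : walk_by id omega n = walk omega n.
Proof. by []. Qed.

Lemma walk_by0 phi omega : walk_by phi omega 0 = 1%g.
Proof. exact: big_ord0. Qed.

Lemma walk_byS phi omega n :
  walk_by phi omega n.+1 = (walk_by phi omega n * phi (omega n : G))%g.
Proof. exact: big_ord_recr. Qed.

Lemma walk_byD phi omega m n :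
  walk_by phi omega (m + n)%N = (walk_by phi omega m * walk_by phi (tailn m omega) n)%g.
Proof. by rewrite /walk_by big_split_ord. Qed.

Lemma walk_by1 phi omega : walk_by phi omega 1 = phi (omega 0%N : G).
Proof. by rewrite walk_byS walk_by0 mul1g. Qed.

Lemma walk_bySl phi omega n : walk_by phi omega n.+1 =
  (phi (omega 0%N : G) * walk_by phi (tailn 1 omega) n)%g.
Proof. by rewrite -add1n walk_byD walk_by1. Qed.

Lemma measurable_walk_by phi n :
  measurable_fun setT (fun omega => walk_by phi omega n : GG).
Proof.
elim: n => [|n IHn].
  rewrite (_ : (walk_by phi)^~ 0%N = cst 1%g); first exact: measurable_cst.
  by apply/funext => omega; exact: walk_by0.
rewrite (_ : (walk_by phi)^~ n.+1 =
  fun omega => (walk_by phi omega n * phi (omega n : G))%g); last first.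
  by apply/funext => omega; exact: walk_byS.
apply: (@measurable_fun_G _ _ (fun omega => walk_by phi omega n)
  (fun omega : Omega => omega n) _ GG (fun g h => (g * phi h)%g)) => //.
exact: measurable_coord.
Qed.

Lemma measurable_walk_by_set phi n (Z : set G) :
  measurable [set omega | Z (walk_by phi omega n)].
Proof.
by apply: (measurable_rel (fun g _ => Z g)); exact: measurable_walk_by.
Qed.

End walks.

Section drift.
Context {R : realType} {G : groupType} {X : metricType R}.
Variable act : G -> X -> X.
Hypothesis cG : countable [set: G].
Hypothesis isoact : isometric_action act.
Notation GG := (discrete_group G).
Notation Omega := (increments G).
Variables (mu : probability GG R) (P : probability Omega R).
Hypothesis PP : is_product_measure mu P.
Variables (phi : G -> G) (o : X).

Definition disp (omega : Omega) n : R := mdist o (act (walk_by phi omega n) o).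

Lemma actM g h x : act (g * h)%g x = act g (act h x).
Proof. by case: isoact => -[]. Qed.

Lemma act1 x : act 1%g x = x.
Proof. by case: isoact => -[]. Qed.

Lemma act_iso g x y : mdist (act g x) (act g y) = mdist x y.
Proof. by case: isoact. Qed.

Lemma disp_ge0 omega n : 0 <= disp omega n.
Proof. exact: mdist_ge0. Qed.

Lemma disp0 omega : disp omega 0 = 0.
Proof. by rewrite /disp walk_by0 act1 mdistxx. Qed.

Lemma disp_tailn omega m n : disp (tailn m omega) n =
  mdist (act (walk_by phi omega m) o) (act (walk_by phi omega (m + n)%N) o).
Proof. by rewrite walk_byD actM act_iso. Qed.

Lemma disp_subadd omega m n : disp omega (m + n)%N <= disp omega m + disp (tailn m omega) n.
Proof. by rewrite disp_tailn; exact: metric_triangle. Qed.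

Lemma measurable_disp n : measurable_fun setT (disp ^~ n).
Proof.
have m := measurable_walk_by cG phi n.
exact: (@measurable_fun_G _ cG _ _ _ _ _ _ (fun g _ => mdist o (act g o)) m m).
Qed.

Hypothesis disp1i : intble P (disp ^~ 1%N).

Lemma measurable_tailn p : measurable_fun setT (@tailn G p).
Proof. exact: measurable_relabel. Qed.

Lemma prob_tailn p F : measurable F -> P (tailn p @^-1` F) = P F.
Proof. by apply: (prob_relabel PP); exact: addnI. Qed.

Lemma intble_tailn p (f : Omega -> R) : intble P f -> intble P (f \o tailn p).
Proof. exact: (intble_comp (measurable_tailn p) (@prob_tailn p)). Qed.

Lemma Rintegral_tailn p (f : Omega -> R) : intble P f ->
  \int[P]_omega f (tailn p omega) = \int[P]_omega f omega.
Proof. exact: (Rintegral_comp (measurable_tailn p) (@prob_tailn p)). Qed.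

Lemma intble_disp n : intble P (disp ^~ n).
Proof.
elim: n => [|n IHn].
  rewrite (_ : disp ^~ 0%N = cst 0); first exact: intble_cst.
  by apply/funext => omega; exact: disp0.
apply: (@intble_le _ _ _ _ _ (fun omega => disp omega n + disp (tailn n omega) 1)).
- exact: measurable_disp.
- by move=> omega; rewrite ger0_norm ?disp_ge0// -addn1; exact: disp_subadd.
- by apply: intbleD => //; exact: (intble_tailn n disp1i).
Qed.

Definition mean_disp n : R := \int[P]_omega disp omega n.

(** By Fekete's lemma, the limit of [mean_disp n / n] under a finite first moment. The infimum gives
    at once a lower bound for all [n] and some [n] that nearly attains it. *)
Definition drift : R := inf [set mean_disp n.+1 / n.+1%:R | n in [set: nat]].

Lemma mean_disp_ge0 n : 0 <= mean_disp n.
Proof. by apply: Rintegral_ge0 => omega _; exact: disp_ge0. Qed.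

Lemma drift_has_inf : has_inf [set mean_disp n.+1 / n.+1%:R | n in [set: nat]].
Proof.
split; first by exists (mean_disp 1 / 1%:R); exists 0%N.
by exists 0 => _ [n _ <-]; rewrite divr_ge0// mean_disp_ge0.
Qed.

Lemma drift_ge0 : 0 <= drift.
Proof.
apply: lb_le_inf; first by case: drift_has_inf.
by move=> _ [n _ <-]; rewrite divr_ge0// mean_disp_ge0.
Qed.

Lemma mean_disp_ge n : n%:R * drift <= mean_disp n.
Proof.
case: n => [|n]; first by rewrite mul0r mean_disp_ge0.
rewrite mulrC -ler_pdivlMr//; apply: ge_inf; first by case: drift_has_inf.
by exists n.
Qed.

Lemma mean_disp_lt c : drift < c -> exists n, (0 < n)%N /\ mean_disp n < n%:R * c.
Proof.
move=> dc; have e0 : 0 < c - drift by rewrite subr_gt0.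
have [_ [n _ <-]] := inf_adherent e0 drift_has_inf.
rewrite -/drift ltr_pdivrMr// => h; exists n.+1; split => //.
by move: h; rewrite mulrC; congr (_ < _ * _); lra.
Qed.

(* For [e < drift], at such times n the Gromov product at o of the k-th and
   n-th points of the walk grows at least linearly in k. *)
Lemma good_times e : 0 < e -> exists M : set Omega, [/\ measurable M, (0 < P M)%E &
  forall omega, M omega -> forall m, exists n, (m <= n)%N /\ forall k, (k <= n)%N ->
    (drift - e) * k%:R + disp (tailn k omega) (n - k)%N <= disp omega n].
Proof.
move=> e0.
pose b n omega := (drift - e) - (disp omega n.+1 - disp (tailn 1 omega) n).
have bi n : intble P (b n).
  apply: intbleB; first exact: intble_cst.
  by apply: intbleB; [exact: intble_disp|exact: (intble_tailn 1 (intble_disp n))].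
have mS := measurable_tailn 1.
pose bad := garsia_set (tailn 1) b.
have mB n : measurable (bad n) := measurable_garsia_set mS (@prob_tailn 1) bi n.
exists (lim_sup_set (fun n => ~` bad n)); split.
- apply: bigcapT_measurable => n; apply: bigcup_measurable => k _.
  exact: measurableC.
- apply: (leaders mS (@prob_tailn 1) bi (H := fun omega => disp omega 1 + e) (e := e)) => //.
  + by apply: intbleD => //; exact: intble_cst.
  + by move=> omega; rewrite addr_ge0 ?disp_ge0// ltW.
  + move=> n omega; have := disp_subadd omega 1 n; rewrite add1n /b.
    by have := drift_ge0; lra.
  (* The invariance of [P] makes the means telescope, and [mean_disp_ge] leaves at most
     [- N * e]. *)
  + move=> N; have -> : \sum_(n < N) \int[P]_omega b n omega =
        N%:R * (drift - e) - mean_disp N.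
      elim: N => [|N IHN].
        rewrite big_ord0 mul0r sub0r /mean_disp; under eq_Rintegral do rewrite disp0.
        by rewrite Rintegral_cstT oppr0.
      rewrite big_ord_recr/= IHN /b RintegralB//; last 2 first.
      * exact: intble_cst.
      * by apply: intbleB; [exact: intble_disp|exact: (intble_tailn 1 (intble_disp N))].
      rewrite RintegralB//; last 2 first.
      * exact: intble_disp.
      * exact: (intble_tailn 1 (intble_disp N)).
      rewrite (Rintegral_tailn 1 (intble_disp N)) Rintegral_cstT.
      by rewrite -/(mean_disp N) -/(mean_disp N.+1) -natr1; lra.
    by have := mean_disp_ge N; lra.
move=> omega Momega m; have [n /= mn nbad] := Momega m I.
exists n.+1; split => [|k kn]; first exact: leqW.
have := @sum_le_garsia_max _ _ _ (tailn 1) b n.+1 k omega kn.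
rewrite (notin_garsia_set nbad) /b.
(* Term [j] compares walks of remaining lengths [n + 1 - j] and [n - j], so the sum telescopes along
   the orbit. *)
have -> : \sum_(j < k) (drift - e - (disp (iter j (tailn 1) omega) (n.+1 - j.+1)%N.+1 -
    disp (tailn 1 (iter j (tailn 1) omega)) (n.+1 - j.+1)%N)) =
    k%:R * (drift - e) - (disp omega n.+1 - disp (tailn k omega) (n.+1 - k)).
  elim: k kn => [|k IHk] kn.
    by rewrite big_ord0 mul0r subn0 tailn0 subrr subr0.
  rewrite big_ord_recr/= IHk; last exact: ltnW.
  have E : (n.+1 - k.+1).+1 = (n.+1 - k)%N by rewrite subnSK.
  rewrite -iterS !iter_tailn1 E -natr1; lra.
lra.
Qed.

(** A good time beyond [k] gives the bound without constant, by subadditivity. The constant [C] lets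
    the property pass from a tail to the sequence, at the price of one increment. *)
Lemma disp_lower e : 0 < e ->
  {ae P, forall omega, exists C, forall k, (drift - e) * k%:R - C <= disp omega k}.
Proof.
move=> e0; have [M [mM PM HM]] := good_times e0.
apply: (ae_backward_invariant PP (p := 1) _ mM PM) => //.
- move=> omega /HM H; exists 0 => k; rewrite subr0.
  have [n [kn /(_ k kn)]] := H k.
  by have := disp_subadd omega k (n - k)%N; rewrite subnKC//; lra.
- move=> omega [C HC]; exists (`|C| + `|drift - e| + disp omega 1) => -[|k].
    by rewrite disp0 mulr0 sub0r oppr_le0 !addr_ge0// disp_ge0.
  have := HC k; rewrite disp_tailn add1n.
  have := metric_triangle (act (walk_by phi omega 1) o) o (act (walk_by phi omega k.+1) o).
  rewrite (metric_sym _ o) -/(disp omega 1) -/(disp omega k.+1) -natr1.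
  have := ler_norm C; have := ler_norm (drift - e); lra.
Qed.

Lemma disp_sum omega n : disp omega n <= \sum_(i < n) disp (tailn i omega) 1.
Proof.
elim: n => [|n IHn]; first by rewrite disp0 big_ord0.
rewrite big_ord_recr/=; have := disp_subadd omega n 1; rewrite addn1; lra.
Qed.

(** The walk is cut into blocks of a length [N] with mean displacement below [N * c]. Sums of block
    displacements are additive along the shift by [N], so [leaders] applies with [b] constant in
    [n]; the incomplete last block is sublinear. *)
Lemma disp_upper c : drift < c ->
  {ae P, forall omega, forall e, 0 < e -> exists C, forall n,
    disp omega n <= C + (c + e) * n%:R}.
Proof.
move=> dc; have c0 : 0 < c := le_lt_trans drift_ge0 dc.
have [N [N0 meanN]] := mean_disp_lt dc.
pose b (n : nat) omega := disp omega N - N%:R * c.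
have bi n : intble P (b n) by apply: intbleB; [exact: intble_disp|exact: intble_cst].
have mS := measurable_tailn N.
pose bad := garsia_set (tailn N) b.
have mB n : measurable (bad n) := measurable_garsia_set mS (@prob_tailn N) bi n.
have blocks : {ae P, forall omega, exists C, forall k,
    \sum_(j < k) disp (tailn (N * j)%N omega) N <= C + N%:R * c * k%:R}.
  apply: (@ae_backward_invariant _ _ _ _ PP _ (lim_sup_set (fun n => ~` bad n)) N) => //.
  - apply: bigcapT_measurable => n; apply: bigcup_measurable => k _.
    exact: measurableC.
  - apply: (leaders mS (@prob_tailn N) bi
      (H := fun omega => disp omega N + N%:R * c) (e := N%:R * c - mean_disp N)) => //.
    + by apply: intbleD; [exact: intble_disp|exact: intble_cst].
    + by move=> omega; rewrite addr_ge0 ?disp_ge0// mulr_ge0// ltW.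
    + by rewrite subr_gt0.
    + by move=> n omega; rewrite /b; have := disp_ge0 omega N; lra.
    + move=> M; rewrite (eq_bigr (fun=> mean_disp N - N%:R * c)); last first.
        move=> i _; rewrite /b RintegralB//; last 2 first.
        * exact: intble_disp.
        * exact: intble_cst.
        by rewrite Rintegral_cstT.
      by rewrite sumr_const card_ord -mulr_natl; lra.
  - move=> omega Momega; exists 0 => k; have [n /= kn nbad] := Momega k I.
    have := @sum_le_garsia_max _ _ _ (tailn N) b n.+1 k omega (leqW kn).
    rewrite (notin_garsia_set nbad) /b big_split/= sumrN sumr_const card_ord.
    rewrite -mulr_natl add0r; under eq_bigr do rewrite iter_tailn.
    by lra.
  - move=> omega [C HC]; exists (`|C| + disp omega N) => -[|k].
      by rewrite big_ord0 mulr0 addr0 addr_ge0// disp_ge0.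
    rewrite big_ord_recl/= muln0 tailn0 -natr1.
    under eq_bigr do rewrite /bump/= add1n mulnS -tailn_tailn.
    have := HC k; have := ler_norm C.
    have : 0 <= N%:R * c by rewrite mulr_ge0// ltW.
    lra.
pose f omega := \sum_(i < N) disp (tailn i omega) 1.
have fi : intble P f.
  apply: (@intble_sum _ _ _ _ N (fun i omega => disp (tailn i omega) 1)) => i.
  exact: (intble_tailn i disp1i).
have f0 omega : 0 <= f omega by apply: sumr_ge0 => *; exact: disp_ge0.
have mf := intble_measurable fi.
(* The growth condition becomes f o S <= f + f o S, trivial for [f >= 0]: an integrable nonnegative
   function is o(k) along orbits. *)
have small := @sublinear _ _ _ P (tailn 1) (measurable_tailn 1) (@prob_tailn 1)
  (fun omega r => f omega <= r) (f \o tailn 1) (intble_tailn 1 fi)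
  (fun=> f0 _).
have {}small : {ae P, forall omega, (exists r, f omega <= r) -> forall e, 0 < e ->
    exists K, forall k, (K <= k)%N -> f (iter k (tailn 1) omega) <= k%:R * e}.
  apply: small.
  - move=> r; rewrite (_ : [set omega | _] = setT `&` f @^-1` `]-oo, r]); first exact: mf.
    by rewrite setTI; apply/seteqP; split => omega; rewrite /= in_itv.
  - by move=> omega r s rs; move/le_trans; apply.
  - by move=> omega r fr /=; rewrite lerDr (le_trans _ fr).
apply: filterS2 blocks small => omega [C HC] small0 e e0.
have {small0} small := small0 (ex_intro _ (f omega) (lexx (f omega))).
have [K HK] := small e e0.
exists (`|C| + \sum_(k < K) f (tailn k omega)) => n.
have mod_lt : (n %% N < N)%N by rewrite ltn_mod.
have q : disp omega (n %/ N * N)%N <= \sum_(j < n %/ N) disp (tailn (N * j)%N omega) N.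
  elim: (n %/ N)%N => [|m IHm]; first by rewrite mul0n disp0 big_ord0.
  rewrite big_ord_recr/= mulSn addnC.
  by have := disp_subadd omega (m * N)%N N; rewrite (mulnC N m); lra.
have r : disp (tailn (n %/ N * N)%N omega) (n %% N)%N <= f (tailn (n %/ N * N)%N omega).
  apply: le_trans (disp_sum _ _) _.
  apply: (@ler_sum_prefix _ (fun i => disp (tailn i _) 1)) (ltnW mod_lt) => i.
  exact: disp_ge0.
have t : f (tailn (n %/ N * N)%N omega) <= \sum_(k < K) f (tailn k omega) + n%:R * e.
  set m := (n %/ N * N)%N; have mn : (m <= n)%N by exact: leq_trunc_div.
  have [Km|mK] := leqP K m.
    have := HK m Km; rewrite iter_tailn1.
    have : 0 <= \sum_(k < K) f (tailn k omega) by exact: sumr_ge0.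
    have : m%:R * e <= n%:R * e by apply: ler_wpM2r; rewrite ?ler_nat// ltW.
    lra.
  rewrite (bigD1 (Ordinal mK))//= -addrA lerDl addr_ge0//.
    by apply: sumr_ge0.
  by rewrite mulr_ge0// ltW.
have := disp_subadd omega (n %/ N * N)%N (n %% N)%N; rewrite -divn_eq.
have := HC (n %/ N)%N; have := ler_norm C.
have : N%:R * c * (n %/ N)%:R <= c * n%:R.
  rewrite mulrAC mulrC -natrM; apply: ler_wpM2l; first exact: ltW.
  by rewrite ler_nat mulnC leq_trunc_div.
lra.
Qed.

Theorem kingman : {ae P, forall omega, forall e, 0 < e -> exists K, forall n,
  (K <= n)%N -> `|disp omega n - drift * n%:R| <= n%:R * e}.
Proof.
have e0 (i : nat) : 0 < i.+1%:R^-1 :> R by rewrite invr_gt0.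
have lo : {ae P, forall omega, forall i : nat, exists C, forall k,
    (drift - i.+1%:R^-1) * k%:R - C <= disp omega k}.
  by apply: ae_foralln => i; exact: disp_lower.
have up : {ae P, forall omega, forall i : nat, forall e, 0 < e -> exists C, forall n,
    disp omega n <= C + (drift + i.+1%:R^-1 + e) * n%:R}.
  by apply: ae_foralln => i; apply: disp_upper; rewrite ltrDl.
apply: filterS2 lo up => omega lo up e e_gt0.
(* The thirds pay for the slope error 1/(i+1), the slack in the upper bound and the additive
   constants. *)
have e3 : 0 < e / 3 by rewrite divr_gt0.
have [i _ /(_ i (leqnn i))/= Hi] := near_infty_natSinv_lt (PosNum e3).
have [C1 HC1] := lo i; have [C2 HC2] := up i (e / 3) e3.
pose C := `|C1| + `|C2|.
exists (Num.bound (C / (e / 3))) => n Cn.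
have C0 : 0 <= C by rewrite addr_ge0.
have : C <= n%:R * (e / 3).
  rewrite -ler_pdivrMr//; apply: le_trans (ltW (archi_boundP _)) _; last by rewrite ler_nat.
  by rewrite divr_ge0// ltW.
have := HC1 n; have := HC2 n; have := ler_norm C1; have := ler_norm C2.
rewrite /C ler_norml.
have : i.+1%:R^-1 * n%:R <= n%:R * (e / 3).
  by rewrite mulrC; apply: ler_wpM2l => //; exact: ltW.
set s := i.+1%:R^-1.
have := normr_ge0 C1; have := normr_ge0 C2; lra.
Qed.

End drift.

(** * Boundary limits and tracking *)

Lemma ae_preimage d (T : measurableType d) (R : realType) (P : probability T R)
    (f : T -> T) (Q : T -> Prop) :
  measurable_fun setT f -> (forall F, measurable F -> P (f @^-1` F) = P F) ->
  {ae P, forall x, Q x} -> {ae P, forall x, Q (f x)}.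
Proof.
move=> mf Pf [N [mN N0 QN]]; exists (f @^-1` N); split.
- by rewrite -[X in measurable X]setTI; exact: mf.
- by rewrite Pf.
- by move=> x /= nQ; exact: QN.
Qed.

Lemma ae_meets d (T : measurableType d) (R : realType) (P : probability T R)
    (E : set T) (Q : T -> Prop) :
  measurable E -> P E <> 0%E -> {ae P, forall x, Q x} -> exists2 x, E x & Q x.
Proof.
move=> mE PE [N [mN N0 QN]]; apply: contrapT => nex; apply: PE.
apply/negligibleP => //; exists N; split => // x Ex; apply: QN => /= Qx.
by apply: nex; exists x.
Qed.

Section boundary_limits.
Context {R : realType} {G : groupType} {X : metricType R}.
Variable act : G -> X -> X.
Hypothesis cG : countable [set: G].
Hypothesis isoact : isometric_action act.
Notation GG := (discrete_group G).
Notation Omega := (increments G).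
Variables (mu : probability GG R) (P : probability Omega R).
Hypothesis PP : is_product_measure mu P.
Context {Xbar : topologicalType}.
Variables (iota : X -> Xbar) (actbar : G -> Xbar -> Xbar).
Hypothesis gX : geodesic_space X.
Hypothesis comp : compactification act iota actbar.
Hypothesis sv : stably_visible iota.
Variables (phi : G -> G) (o : X).

Lemma boundary_actbar g xi : boundary iota xi -> boundary iota (actbar g xi).
Proof.
have [[_ _ _ [[a1 aM] _] equi] _] := comp.
move=> bxi [y _ yg]; apply: bxi; exists (act g^-1%g y) => //.
by rewrite -equi yg -aM mulVg a1.
Qed.

Definition limit_point omega (xi : Xbar) : Prop :=
  iota (act (walk_by phi omega n) o) @[n --> \oo] --> xi.

Lemma succ_cvg (u : nat -> Xbar) (xi : Xbar) :
  u n.+1 @[n --> \oo] --> xi -> u n @[n --> \oo] --> xi.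
Proof.
by move=> ux V /ux[N _ HN]; exists N.+1 => // -[//|n] /= Nn; exact: HN.
Qed.

Lemma limit_point_tailn omega xi : limit_point (tailn 1 omega) xi ->
  limit_point omega (actbar (phi (omega 0%N)) xi).
Proof.
have [[_ _ _ [_ conti] equi] _] := comp.
move=> lxi; apply: succ_cvg.
under eq_fun do rewrite walk_bySl (actM isoact) -equi.
by apply: (cvg_comp _ _ lxi); exact: conti.
Qed.

Hypothesis disp1i : intble P (fun omega => disp act phi o omega 1%N).
Hypothesis drift_gt0 : 0 < drift act P phi o.

Lemma walk_converges :
  {ae P, forall omega, exists2 xi, boundary iota xi & limit_point omega xi}.
Proof.
have [[[hX scX] hi _ _ equi] cX] := comp.
have e0 : 0 < drift act P phi o / 2 by rewrite divr_gt0.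
have [M [mM PM HM]] := good_times cG isoact PP disp1i e0.
apply: (ae_backward_invariant PP (p := 1) _ mM PM) => //.
- move=> omega /HM good.
  apply: (drift_converges gX sv hi hX scX cX e0) => m.
  have [n [mn Hn]] := good m; exists n; split => // k kn.
  have := Hn k kn; rewrite (disp_tailn isoact) subnKC// walk_by0 (act1 isoact) /disp.
  by set D := drift _ _ _ _; lra.
- move=> omega [xi bxi lxi]; exists (actbar (phi (omega 0%N)) xi).
    exact: boundary_actbar.
  exact: limit_point_tailn.
Qed.

(** A measurable substitute for the event that the limit lies in [U]. When the walk converges and
    [U] is open, it lies between that event and the event that the limit lies in the closure of
    [U]. *)
Definition eventually_in (U : set Xbar) : set Omega :=
  [set omega | \forall n \near \oo, U (iota (act (walk_by phi omega n) o))].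

Lemma measurable_eventually_in U : measurable (eventually_in U).
Proof.
have -> : eventually_in U = \bigcup_N \bigcap_(n in [set n | (N <= n)%N])
    [set omega | U (iota (act (walk_by phi omega n) o))].
  apply/seteqP; split => [omega [N _ HN]|omega [N _ HN]]; first by exists N.
  by exists N.
apply: bigcupT_measurable => N; apply: bigcap_measurableType => n _.
exact: (measurable_walk_by_set cG phi n (fun g => U (iota (act g o)))).
Qed.

(** The support of the law of the limit point. *)
Definition in_support (xi : Xbar) : Prop :=
  forall U, open U -> U xi -> P (eventually_in U) <> 0%E.

(** A limit outside the support lies in a basic open set that the walk eventually enters with
    probability 0, and there are countably many of these. *)
Lemma limit_in_support : {ae P, forall omega, exists xi,
  [/\ boundary iota xi, in_support xi & limit_point omega xi]}.
Proof.
have [[[_ [B /pcard_injP[f finj] [oB bB]]] _ _ _ _] _] := comp.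
suff null : {ae P, forall omega xi, limit_point omega xi -> in_support xi}.
  apply: filterS2 null walk_converges => omega h [xi bxi lxi].
  by exists xi; split => //; exact: h.
pose bad n := [set omega | exists W, [/\ B W, f W = n, P (eventually_in W) = 0%E &
  eventually_in W omega]].
have badN n : P.-negligible (bad n).
  have [[W [BW fW PW]]|nex] := pselect (exists W, [/\ B W, f W = n & P (eventually_in W) = 0%E]).
    exists (eventually_in W); split => //; first exact: measurable_eventually_in.
    move=> omega [W' [BW' fW' _ ]]; suff -> : W' = W by [].
    by apply: finj; rewrite ?inE// fW'.
  rewrite (_ : bad n = set0); first exact: negligible_set0.
  by rewrite -subset0 => omega [W [BW fW PW _]]; apply: nex; exists W.
apply: negligibleS (negligible_bigcup badN) => omega /= /existsNP[xi].
move=> /not_implyP[lxi /existsNP[U /not_implyP[oU /not_implyP[Uxi /contrapT PU]]]].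
have [W [BW Wxi] WU] : filter_from [set W | B W /\ W xi] id U.
  by apply: bB; apply: open_nbhs_nbhs.
exists (f W) => //; exists W; split => //.
  apply/negligibleP; first exact: measurable_eventually_in.
  exists (eventually_in U); split => //; first exact: measurable_eventually_in.
  by move=> omega' /= [N _ HN]; exists N => // n /= /HN; exact: WU.
by apply: lxi; apply: open_nbhs_nbhs; split => //; exact: oB.
Qed.

Lemma support_nonempty : exists xi, boundary iota xi /\ in_support xi.
Proof.
have PT : P setT <> 0%E by rewrite probability_setT; exact/eqP/oner_neq0.
have [omega _ [xi [bxi sxi _]]] := ae_meets measurableT PT limit_in_support.
by exists xi.
Qed.

End boundary_limits.

(** * Constant limits and elementary subgroups *)

Section fixed_point.
Context {R : realType} {G : groupType} {X : metricType R}.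
Variable act : G -> X -> X.
Hypothesis cG : countable [set: G].
Hypothesis isoact : isometric_action act.
Notation GG := (discrete_group G).
Notation Omega := (increments G).
Variables (mu : probability GG R) (P : probability Omega R).
Hypothesis PP : is_product_measure mu P.
Context {Xbar : topologicalType}.
Variables (iota : X -> Xbar) (actbar : G -> Xbar -> Xbar).
Hypothesis comp : compactification act iota actbar.
Variable o : X.

(** The first increment equals an atom [g] of [mu] with positive probability. Then some sequence
    starts with [g] while it and its tail both converge to [xi]; but its limit is also
    [actbar g xi]. The stabilizer of [xi] thus contains the generated subgroup. *)
Lemma constant_limit_elementary xi :
  boundary iota xi -> {ae P, forall omega, limit_point act iota id o omega xi} ->
  elementary iota actbar (generated_subgroup (measure_support mu)).
Proof.
have [[[hX scX] hi _ [[a1 aM] conti] equi] cX] := comp.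
move=> bxi lim.
have fixed g : measure_support mu g -> actbar g xi = xi.
  move=> mug.
  pose E := cylinder 1 id (fun=> [set (g : GG)]).
  have mE : measurable E by exact: measurable_cylinder.
  have PE : P E <> 0%E.
    rewrite (prob_cylinder PP)// big_ord1; apply/eqP; rewrite -measure_gt0//.
  have lim1 := ae_preimage (measurable_tailn 1) (@prob_tailn _ _ _ _ PP 1) lim.
  have lim2 : {ae P, forall omega, limit_point act iota id o omega xi /\
      limit_point act iota id o (tailn 1 omega) xi}.
    by apply: filterS2 lim lim1 => omega.
  have [omega Eom [l0 l1]] := ae_meets mE PE lim2.
  have /= om0 := Eom 0%N isT.
  have := limit_point_tailn isoact comp l1; rewrite om0 => l1'.
  exact: (cvg_unique hX l1' l0).
have fixH : generated_subgroup (measure_support mu) `<=` [set g | actbar g xi = xi].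
  apply: smallest_sub => //; split; first by apply/mem_set; exact: a1.
  move=> g h /set_mem/= gx /set_mem/= hx; apply/mem_set => /=.
  have hVx : actbar h^-1%g xi = xi by rewrite -{1}hx -aM mulVg a1.
  by rewrite aM hVx gx.
exists [set xi]; split => //.
- by exists xi.
- by move=> _ ->.
- by move=> g /fixH/= gx; rewrite image_set1 gx.
Qed.

End fixed_point.

(** * The bilateral walk *)

Section bilateral.
Context {R : realType} {G : groupType} {X : metricType R}.
Variable act : G -> X -> X.
Hypothesis cG : countable [set: G].
Hypothesis isoact : isometric_action act.
Notation GG := (discrete_group G).
Notation Omega := (increments G).
Variables (mu : probability GG R) (P : probability Omega R).
Hypothesis PP : is_product_measure mu P.
Context {Xbar : topologicalType}.
Variables (iota : X -> Xbar) (actbar : G -> Xbar -> Xbar).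
Hypothesis pX : proper_space X.
Hypothesis gX : geodesic_space X.
Hypothesis comp : compactification act iota actbar.
Hypothesis sv : stably_visible iota.
Hypothesis nelem :
  ~ elementary iota actbar (generated_subgroup (measure_support mu)).
Variable o : X.
Let inv (g : G) : G := g^-1%g.

Hypothesis moment : intble P (fun omega => disp act id o omega 1%N).

Lemma disp_inv1 omega : disp act inv o omega 1 = disp act id o omega 1.
Proof.
rewrite /disp !walk_by1 -(act_iso isoact (omega 0%N : G)) -(actM isoact).
by rewrite /inv mulgV (act1 isoact) metric_sym.
Qed.

Lemma moment_inv : intble P (fun omega => disp act inv o omega 1%N).
Proof. by move: moment; congr (intble P _); apply/funext => omega; rewrite disp_inv1. Qed.

Lemma walk_rev (omega : Omega) n :
  (\prod_(i < n) inv (omega (n - i.+1)%N))%g = (walk_by id omega n)^-1%g.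
Proof.
elim: n => [|n IHn]; first by rewrite big_ord0 walk_by0 invg1.
rewrite big_ord_recl/= walk_byS invgM subn1/=; congr (_ * _)%g.
by rewrite -IHn; apply: eq_bigr => i _; rewrite /bump/= add1n subSS.
Qed.

(** Reversing the first [n] increments turns the backward walk at time [n] into the inverse of the
    forward one, with the same displacement. [rho] fixes the later indices, so it is injective and
    preserves [P]. *)
Lemma mean_disp_inv n : mean_disp act P inv o n = mean_disp act P id o n.
Proof.
pose rho k := if (k < n)%N then (n - k.+1)%N else k.
have rho_inj : injective rho.
  by move=> k l; rewrite /rho; case: ifPn => hk; case: ifPn => hl; lia.
have := Rintegral_transfer (measurable_relabel rho) (@prob_relabel _ _ _ _ PP rho rho_inj)
  (intble_disp cG isoact PP moment_inv n).
rewrite /mean_disp => ->; apply: eq_Rintegral => omega _; rewrite /disp.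
have -> : walk_by inv (relabel rho omega) n = (walk_by id omega n)^-1%g.
  rewrite -walk_rev; apply: eq_bigr => i _.
  by rewrite /relabel /rho ltn_ord.
rewrite -(act_iso isoact (walk_by id omega n)) -(actM isoact) mulgV.
by rewrite (act1 isoact) metric_sym.
Qed.

Lemma drift_inv : drift act P inv o = drift act P id o.
Proof.
rewrite /drift; congr (inf _); apply: eq_imagel => n _.
by rewrite mean_disp_inv.
Qed.

Hypothesis drift_gt0 : 0 < drift act P id o.

(* Forward and backward limits are independent, so if they always coincided
   they would be a single point, fixed by the support of mu. *)
Lemma distinct_supports : exists xi eta, [/\ in_support act P iota id o xi,
  in_support act P iota inv o eta & eta <> xi].
Proof.
apply: contrapT => nex; apply: nelem.
have lim_id := limit_in_support cG isoact PP gX comp sv moment drift_gt0.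
have dinv : 0 < drift act P inv o by rewrite drift_inv.
(* One backward support point is enough: without a distinct pair, almost every forward limit, being
   in the forward support, equals [eta]. *)
have [eta [beta seta]] := support_nonempty cG isoact PP gX comp sv moment_inv dinv.
apply: (constant_limit_elementary isoact PP comp (o := o) beta).
apply: filterS lim_id => omega [xi [bxi sxi lxi]].
suff -> : eta = xi by [].
by apply: contrapT => neq; apply: nex; exists xi, eta.
Qed.

(* A single sequence in G^N carries a bi-infinite walk: its even coordinates
   are the increments g_1, g_2, ... and its odd ones g_0, g_(-1), ...; the
   shift of Z becomes the injection [bishift_index]. *)
Definition fwd_index (k : nat) : nat := k.*2.
Definition bwd_index (k : nat) : nat := k.*2.+1.
Definition bishift_index (k : nat) : nat :=
  if odd k then k.-2 else k.+2.

(** The truncation [1.-2 = 0] matters: index 1 takes the coordinate 0, which the even indices leave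
    free. In this way g_1 becomes the first backward increment. *)
Lemma bishift_index_inj : injective bishift_index.
Proof.
by move=> k l; rewrite /bishift_index; case: ifPn; case: ifPn; lia.
Qed.

Definition bishift : Omega -> Omega := relabel bishift_index.

Definition fwd (omega : Omega) n : G := walk_by id (relabel fwd_index omega) n.
Definition bwd (omega : Omega) n : G := walk_by inv (relabel bwd_index omega) n.

Lemma fwd_bishift omega n :
  fwd (bishift omega) n = ((omega 0%N : G)^-1 * fwd omega n.+1)%g.
Proof.
rewrite [X in (_ * X)%g]walk_bySl mulKg /fwd; congr (walk_by id _ n).
apply/funext => i; rewrite /tailn /bishift /relabel /fwd_index /bishift_index.
by rewrite odd_double/= add1n doubleS.
Qed.

Lemma bwd_bishift omega n :
  bwd (bishift omega) n.+1 = ((omega 0%N : G)^-1 * bwd omega n)%g.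
Proof.
rewrite /bwd walk_bySl; congr (_ * walk_by inv _ n)%g.
apply/funext => i; rewrite /tailn /bishift /relabel /bwd_index /bishift_index.
by rewrite add1n doubleS /= odd_double.
Qed.

Lemma bwd0 omega : bwd omega 0 = 1%g.
Proof. exact: walk_by0. Qed.

(** Seen from the [k]-th point of the walk, the starting point is the backward point of time [k]. *)
Lemma iter_bishift omega k : bwd (iter k bishift omega) k = (fwd omega k)^-1%g /\
  forall n, fwd (iter k bishift omega) n = ((fwd omega k)^-1 * fwd omega (k + n)%N)%g.
Proof.
elim: k => [|k [IHb IHf]].
  rewrite bwd0 /fwd walk_by0 invg1; split => // n.
  by rewrite mul1g.
have e1 : (iter k bishift omega 0%N : G) = ((fwd omega k)^-1 * fwd omega k.+1)%g.
  rewrite -addn1 -IHf /fwd walk_by1.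
  by [].
rewrite iterS; split => [|n].
  by rewrite bwd_bishift IHb e1 invgM invgK mulgK.
by rewrite fwd_bishift IHf e1 invgM invgK mulgA mulgK addnS.
Qed.

Lemma near_geodesics_act g x y z r : near_geodesics x y z r ->
  near_geodesics (act g x) (act g y) (act g z) r.
Proof.
move=> h a b gamma [ab iso ga gb].
have [|t tab xt] := h a b (act g^-1%g \o gamma).
  split => //=.
  - by move=> s t sI tI; rewrite /= (act_iso isoact); exact: iso.
  - by rewrite ga -(actM isoact) mulVg (act1 isoact).
  - by rewrite gb -(actM isoact) mulVg (act1 isoact).
exists t => //; move: xt => /=; rewrite -(act_iso isoact g) -[X in mdist _ X](actM isoact).
by rewrite mulgV (act1 isoact).
Qed.

Definition near_all (omega : Omega) (r : R) : Prop := forall m n,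
  near_geodesics o (act (bwd omega m) o) (act (fwd omega n) o) r.

Lemma near_all_bishift omega r : near_all omega r ->
  near_all (bishift omega) (r + disp act id o (relabel fwd_index omega) 1).
Proof.
move=> h; have r0 : 0 <= r.
  have [|t _] := h 0%N 0%N 0 0 (fun=> o).
    rewrite /fwd bwd0 walk_by0 (act1 isoact); split => // s t.
    rewrite /= !in_itv/= => /andP[s0 s1] /andP[t0 t1]; rewrite mdistxx.
    by rewrite (_ : s - t = 0) ?normr0//; lra.
  by rewrite mdistxx.
(* The new backward point of time 0 is [o] itself, where the bound is trivial; the later ones are
   translates of old backward points. *)
move=> [|m] n.
  rewrite bwd0 (act1 isoact).
  have h0 : 0 <= r + disp act id o (relabel fwd_index omega) 1.
    by rewrite addr_ge0// disp_ge0.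
  exact: near_geodesics_le h0 (@near_geodesics_endl _ _ _ _).
rewrite bwd_bishift fwd_bishift !(actM isoact).
have := @near_geodesics_act (omega 0%N : G)^-1%g _ _ _ _
  (@near_geodesics_move _ _ _ (act (omega 0%N : G) o) _ _ _ (h m n.+1)).
rewrite -[act _ (act (omega 0%N : G) o)](actM isoact) mulVg (act1 isoact).
by rewrite /disp walk_by1 metric_sym.
Qed.

Lemma measurable_near_all r : measurable [set omega | near_all omega r].
Proof.
have -> : [set omega | near_all omega r] = \bigcap_m \bigcap_n
    [set omega | near_geodesics o (act (bwd omega m) o) (act (fwd omega n) o) r].
  by apply/seteqP; split => [omega h m _ n _|omega h m n]; [exact: h|exact: h].
apply: bigcapT_measurable => m; apply: bigcapT_measurable => n.
apply: (measurable_rel cG (fun g h => near_geodesics o (act g o) (act h o) r)).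
- exact: measurableT_comp (measurable_walk_by cG inv m) (measurable_relabel bwd_index).
- exact: measurableT_comp (measurable_walk_by cG id n) (measurable_relabel fwd_index).
Qed.

Lemma fwd_index_inj : injective fwd_index. Proof. by move=> k l; rewrite /fwd_index; lia. Qed.
Lemma bwd_index_inj : injective bwd_index. Proof. by move=> k l; rewrite /bwd_index; lia. Qed.
Lemma fwd_bwd_index k l : fwd_index k <> bwd_index l.
Proof. by rewrite /fwd_index /bwd_index; lia. Qed.

(** Only the forward walk appears, so that recurrence under the one-sided shift applies; the
    tolerances 1/(i+1) keep the event measurable. *)
Definition tracked (omega : Omega) : Prop := forall i : nat, exists K : nat,
  forall k, (K <= k)%N -> forall n, near_geodesics (act (walk_by id omega k) o) o
    (act (walk_by id omega (k + n)%N) o) (k%:R * i.+1%:R^-1).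

Lemma measurable_tracked : measurable tracked.
Proof.
have -> : tracked = \bigcap_(i : nat) \bigcup_(K : nat)
    \bigcap_(k in [set k | (K <= k)%N]) \bigcap_(n : nat)
    [set omega | near_geodesics (act (walk_by id omega k) o) o
      (act (walk_by id omega (k + n)%N) o) (k%:R * i.+1%:R^-1)].
  apply/seteqP; split => [omega h i _|omega h i].
    by have [K HK] := h i; exists K => // k Kk n _; exact: HK.
  by have [K _ HK] := h i I; exists K => k Kk n; exact: HK.
apply: bigcapT_measurable => i; apply: bigcupT_measurable => K.
apply: bigcap_measurableType => k _; apply: bigcapT_measurable => n.
by apply: (measurable_rel cG (fun g h => near_geodesics (act g o) o (act h o) _));
  exact: measurable_walk_by.
Qed.

Lemma ae_near_all : {ae P, forall omega, (exists r, near_all omega r) ->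
  tracked (relabel fwd_index omega)}.
Proof.
have mS := measurable_relabel (G := G) bishift_index.
have PS := @prob_relabel _ _ _ _ PP _ bishift_index_inj.
have hi : intble P (fun omega => disp act id o (relabel fwd_index omega) 1).
  exact: (integrable_transfer (measurable_relabel fwd_index)
    (@prob_relabel _ _ _ _ PP _ fwd_index_inj) moment).
have := sublinear mS PS (L := near_all) hi (fun omega => disp_ge0 _ _ _ _ _)
  measurable_near_all _ near_all_bishift.
move=> sub; apply: filterS (sub _) => [omega h ex i|omega r s rs nr m n]; last first.
  exact: near_geodesics_le rs (nr m n).
have [|K HK] := h ex i.+1%:R^-1; first by rewrite invr_gt0.
exists K => k Kk n.
(* The backward time is chosen equal to [k]: translation by the [k]-th position then sends the
   backward endpoint to [o]. *)
have := @near_geodesics_act (fwd omega k) _ _ _ _ (HK k Kk k n).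
have [-> ->] := iter_bishift omega k.
by rewrite -!(actM isoact) mulgA mulgV mul1g (act1 isoact).
Qed.

Lemma prob_tracked : (0 < P tracked)%E.
Proof.
have [[[hX scX] hi _ _ _] cX] := comp.
have [xi [eta [sxi seta neq]]] := distinct_supports.
move: (hX); rewrite open_hausdorff => /(_ eta xi).
have /eqP neq' := neq; move=> /(_ neq')[[V U] /= [/set_mem Veta /set_mem Uxi] [oV oU VU]].
(* A walk that stays in [W] has its limit only in the closure of [W], hence the smaller
   neighbourhood. *)
have reg : {for xi, regular_space Xbar} := compact_regular hX cX filterT.
have [W nW WU] := reg _ U (open_nbhs_nbhs (conj oU Uxi)).
have sW : P (eventually_in act iota id o W°) <> 0%E.
  by apply: sxi; [exact: open_interior|exact: nbhs_singleton (nbhs_interior nW)].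
have sV := seta V oV Veta.
pose E := relabel fwd_index @^-1` eventually_in act iota id o W° `&`
  relabel bwd_index @^-1` eventually_in act iota inv o V.
have mW := measurable_eventually_in act cG iota id o W°.
have mV := measurable_eventually_in act cG iota inv o V.
have mE : measurable E by apply: measurableI; exact: measurable_relabel_preimage.
have PE : P E <> 0%E.
  rewrite (indep_relabel PP fwd_index_inj bwd_index_inj fwd_bwd_index)//.
  by apply/eqP; rewrite mule_eq0 negb_or; apply/andP; split; apply/eqP.
have dinv : 0 < drift act P inv o by rewrite drift_inv.
have limf := ae_preimage (measurable_relabel fwd_index)
  (@prob_relabel _ _ _ _ PP _ fwd_index_inj)
  (walk_converges cG isoact PP gX comp sv moment drift_gt0).
have limb := ae_preimage (measurable_relabel bwd_index)
  (@prob_relabel _ _ _ _ PP _ bwd_index_inj)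
  (walk_converges cG isoact PP gX comp sv moment_inv dinv).
have aeE : {ae P, forall omega, E omega -> tracked (relabel fwd_index omega)}.
  apply: filterS3 limf limb ae_near_all => omega [a ba la] [b bb lb] h [Ef Eb].
  apply: h.
  have [C HC] : exists C, forall m n, near_geodesics o
      (act (bwd omega m) o) (act (fwd omega n) o) C.
    apply: (near_bounded (iota := iota) o sv ba la bb lb) => ab.
    have nbU : nbhs b U.
      apply: open_nbhs_nbhs; split => //; rewrite ab; apply: WU => B /la aB.
      have [n [/interior_subset Wn Bn]] := filter_ex (filterI Ef aB).
      by eexists; split; [exact: Wn|exact: Bn].
    have [n [Vn Un]] := filter_ex (filterI Eb (lb U nbU)).
    by move/eqP: VU; rewrite -subset0 => /(_ _ (conj Vn Un)).
  by exists C.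
rewrite lt0e measure_ge0 andbT; apply/eqP => P0; apply: PE.
apply/negligibleP => //.
have : P.-negligible (relabel fwd_index @^-1` tracked).
  apply/negligibleP; first by apply: measurable_relabel_preimage; exact: measurable_tracked.
  by rewrite -P0; exact: (prob_relabel PP fwd_index_inj measurable_tracked).
move: aeE => /negligibleU/[apply]; apply: negligibleS => omega Eom.
have [t|nt] := pselect (tracked (relabel fwd_index omega)); first by right.
by left => /= h; apply: nt; exact: h.
Qed.

Lemma ae_tracking : {ae P, forall omega, exists2 gamma : R -> X, geodesic_ray gamma &
  mdist (act (walk omega n) o) (gamma (drift act P id o * n%:R)) / n%:R
    @[n --> \oo] --> (0 : R)}.
Proof.
set A := drift act P id o.
pose Q (omega : Omega) := exists2 gamma : R -> X, geodesic_ray gamma &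
  mdist (act (walk_by id omega n) o) (gamma (A * n%:R)) / n%:R @[n --> \oo] --> (0 : R).
(* The ray is translated by the first increment. The shift of time by one step costs the constant
   [A], at most [n * (e / 2)] for large [n]. *)
have QS omega : Q (tailn 1 omega) -> Q omega.
  move=> [gamma rg cg]; pose g := (omega 0%N : G).
  exists (act g \o gamma).
    by move=> s t sI tI /=; rewrite (act_iso isoact); exact: rg.
  apply/(@cvgrPdist_le _ R^o) => e e0.
  have e2 : 0 < e / 2 by rewrite divr_gt0.
  have /(@cvgrPdist_le _ R^o)/(_ _ e2)[K _ HK] := cg.
  exists (maxn K (Num.bound (A / (e / 2)))).+1 => // -[//|n].
  rewrite /= ltnS geq_max => /andP[/HK/=].
  rewrite !sub0r !normrN !ger0_norm ?divr_ge0 ?mdist_ge0// => hn bn.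
  rewrite walk_bySl (actM isoact) (act_iso isoact) -/g.
  have An : A <= n%:R * (e / 2).
    rewrite -ler_pdivrMr//; apply: le_trans (ltW (archi_boundP _)) _; last by rewrite ler_nat.
    by rewrite divr_ge0// ltW.
  have A0 : 0 < A := drift_gt0.
  have n0 : (0 < n)%N.
    by rewrite lt0n; apply/negP => /eqP n0; move: An; rewrite n0 mul0r leNgt A0.
  move: hn; rewrite !ler_pdivrMr ?ltr0n// => hn.
  have : mdist (gamma (A * n%:R)) (gamma (A * n.+1%:R)) = A.
    rewrite rg/= ?in_itv/= ?andbT; last 2 first.
    - by rewrite mulr_ge0// ltW.
    - by rewrite mulr_ge0// ltW.
    by rewrite distrC -natr1 mulrDr mulr1 addrAC subrr add0r ger0_norm// ltW.
  have := metric_triangle (act (walk_by id (tailn 1 omega) n) o)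
    (gamma (A * n%:R)) (gamma (A * n.+1%:R)).
  by rewrite -[in X in _ -> _ -> _ <= X]natr1; lra.
have king := kingman cG isoact PP moment.
(* The recurrence time depends on [omega], so the speed is secured for all tails at once. *)
have kings : {ae P, forall omega, forall n : nat, forall e, 0 < e -> exists K, forall k,
  (K <= k)%N -> `|disp act id o (tailn n omega) k - A * k%:R| <= k%:R * e}.
  apply: ae_foralln => n.
  exact: (ae_preimage (measurable_tailn n) (@prob_tailn _ _ _ _ PP n) king).
have recur := recurrence PP (ltnSn 0) measurable_tracked prob_tracked.
apply: filterS2 kings recur => omega kings [n]; rewrite mul1n => trn.
have : Q (tailn n omega).
  have x0 : act (walk_by id (tailn n omega) 0) o = o by rewrite walk_by0 (act1 isoact).
  have := @tracking _ X (fun k => act (walk_by id (tailn n omega) k) o) A pX gX drift_gt0.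
  rewrite x0; apply; first exact: kings.
  move=> e e0; have [i _ /(_ i (leqnn i))/= Hi] := near_infty_natSinv_lt (PosNum e0).
  have [K HK] := trn i; exists K => k Kk m km.
  have := HK k Kk (m - k)%N; rewrite subnKC//.
  by apply: near_geodesics_le; rewrite ler_wpM2l// ltW.
elim: n {kings trn} => [//|n IHn] Qn; apply: IHn; apply: QS.
by rewrite tailn_tailn addn1.
Qed.

End bilateral.

Theorem theorem2 (R : realType) (G : groupType) (X : metricType R)
    (act : G -> X -> X)
    (Xbar : topologicalType) (iota : X -> Xbar) (actbar : G -> Xbar -> Xbar)
    (mu : probability (discrete_group G) R)
    (P : probability (increments G) R) :
  countable [set: G] ->
  proper_space X -> geodesic_space X ->
  isometric_action act ->
  compactification act iota actbar ->
  nontrivial_bordification iota ->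
  stably_visible iota ->
  is_product_measure mu P ->
  ~ elementary iota actbar (generated_subgroup (measure_support mu)) ->
  finite_first_moment act mu ->
  exists2 A : R, 0 <= A &
    forall x : X,
      {ae P, forall omega : increments G,
        exists2 gamma : R -> X, geodesic_ray gamma &
          mdist (act (walk omega n) x) (gamma (A * n%:R)) / n%:R
            @[n --> \oo] --> (0 : R)}.
Proof.
move=> cG pX gX isoact comp [p [_ [_ [[bp _ _] _]]]] sv PP nelem [ o fo].
have moment : intble P (fun omega => disp act id o omega 1%N).
  have mD : measurable_fun setT (fun g : discrete_group G => mdist o (act g o)).
    by [].
  have int : mu.-integrable setT (EFin \o (fun g : discrete_group G => mdist o (act g o))).
    apply/integrableP; split; first exact/measurable_EFinP.
    by under eq_integral do rewrite /= ger0_norm ?mdist_ge0//.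
  have mc := @measurable_coord G 0.
  have Pmu (F : set (discrete_group G)) : measurable F ->
      P ((fun omega : increments G => omega 0%N) @^-1` F) = mu F.
    move=> _; have := @prob_cylinder _ _ _ _ PP 1 id (fun=> F) (fun k l _ _ kl => kl).
    rewrite big_ord1 => <- //; congr (P _).
    by apply/seteqP; split => [omega Fo [|]//|omega /(_ 0%N isT)].
  have := integrable_transfer mc Pmu int.
  congr (integrable _ _ _); apply/funext => omega /=.
  by rewrite /disp walk_by1.
exists (drift act P id o); first exact: drift_ge0.
move=> x.
have step : {ae P, forall omega : increments G, exists2 gamma : R -> X, geodesic_ray gamma &
    mdist (act (walk omega n) o) (gamma (drift act P id o * n%:R)) / n%:R
            @[n --> \oo] --> (0 : R)}.
  have := drift_ge0 act P id o; rewrite le_eqVlt => /orP[/eqP A0|A0]; last first.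
    exact: (ae_tracking cG isoact PP pX gX comp sv nelem moment A0).
  have [[[hX scX] hi [_ dI] _ _] cX] := comp.
  have [gamma rg] := ray_exists pX gX hi hX dI (ex_intro _ p bp).
  apply: filterS (kingman cG isoact PP moment) => omega king; exists gamma => //.
  apply/(@cvgrPdist_le _ R^o) => e e0.
  have e2 : 0 < e / 2 by rewrite divr_gt0.
  have [K HK] := king _ e2.
  exists (maxn 1 (maxn K (Num.bound (mdist o (gamma 0) / (e / 2))))) => // n.
  rewrite /= !geq_max => /and3P[n1 /HK + bn].
  rewrite -A0 !mul0r subr0 ger0_norm ?disp_ge0// => hn.
  have n0 : 0 < n%:R :> R by rewrite ltr0n.
  rewrite sub0r normrN ger0_norm ?divr_ge0 ?mdist_ge0// ler_pdivrMr//.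
  have : mdist o (gamma 0) <= n%:R * (e / 2).
    rewrite -ler_pdivrMr//; apply: le_trans (ltW (archi_boundP _)) _; last by rewrite ler_nat.
    by rewrite divr_ge0 ?mdist_ge0// ltW.
  have := metric_triangle (act (walk omega n) o) o (gamma 0).
  rewrite (metric_sym _ o) -/(disp act id o omega n); move: hn; rewrite /disp walk_by_id; lra.
(* As [w_n] acts by an isometry, replacing [o] by [x] displaces the sample path by the constant d(x,
   o), so the same ray serves. *)
apply: filterS step => omega [gamma rg cg]; exists gamma => //.
apply/(@cvgrPdist_le _ R^o) => e e0.
have e2 : 0 < e / 2 by rewrite divr_gt0.
have /(@cvgrPdist_le _ R^o)/(_ _ e2)[K _ HK] := cg.
exists (maxn 1 (maxn K (Num.bound (mdist x o / (e / 2))))) => // n.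
rewrite /= !geq_max => /and3P[n1 /HK/= + bn].
have n0 : 0 < n%:R :> R by rewrite ltr0n.
rewrite !sub0r !normrN !ger0_norm ?divr_ge0 ?mdist_ge0// !ler_pdivrMr// => hn.
have : mdist x o <= n%:R * (e / 2).
  rewrite -ler_pdivrMr//; apply: le_trans (ltW (archi_boundP _)) _; last by rewrite ler_nat.
  by rewrite divr_ge0 ?mdist_ge0// ltW.
rewrite -(act_iso isoact (walk omega n)).
have := metric_triangle (act (walk omega n) x) (act (walk omega n) o)
  (gamma (drift act P id o * n%:R)); lra.
Qed.
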